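(* Let $c\in\mathbb{N}\cup\{0\}\cup\{-1\}$, $m\in\mathbb{Z}$, $\alpha\ge 1$, $0\le\beta\le1$ and $\phi(x)=\sqrt{x(1+cx)}$. For $f\in C_B[0,\infty)$ we have $$\left|F_{n,m}^{c,\alpha}(f;x)-f(x)\right|\le C\,\omega_{\phi^\beta}\!\left(f;\frac{\phi^{1-\beta}(x)}{\sqrt n}\right)$$ for sufficiently large $n$, where $C$ is a positive constant independent of $f$ and $n$.
   Context: Here $\mathbb{N}=\{1,2,\dots\}$, $n\in\mathbb{N}$, and $C_B[0,\infty)$ is the space of continuous and bounded functions on $[0,\infty)$. Put $\phi_{N,0}(x)=e^{-Nx}$, $\phi_{N,-1}(x)=(1-x)^{N}$ and $\phi_{N,c}(x)=(1+cx)^{-N/c}$ for $c=1,2,3,\dots$, and for $k=0,1,2,\dots$ let $$p_{N,k}(x;c)=\frac{(-x)^k}{k!}\,\phi_{N,c}^{(k)}(x);$$ in particular $p_{N,k}(x;-1)=\binom{N}{k}x^k(1-x)^{N-k}$. Let $$J_{n+mc,k}(x,c)=\sum_{j=k}^\infty p_{n+mc,j}(x;c),\qquad Q^{(\alpha)}_{n+mc,k}(x;c)=\big(J_{n+mc,k}(x,c)\big)^\alpha-\big(J_{n+mc,k+1}(x,c)\big)^\alpha .$$ The operators are $$F_{n,m}^{c,\alpha}(f;x)=\{n+(m+1)c\}\sum_{k=1}^\infty Q^{(\alpha)}_{n+mc,k}(x;c)\int_0^\infty p_{n+(m+2)c,k-1}(t;c)f(t)\,dt+Q^{(\alpha)}_{n+mc,0}(x;c)f(0).$$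 For $c=-1$ (Bernstein-Durrmeyer case) this is read with the sum over $1\le k\le n-m-1$, the integrals over $[0,1]$, and the additional term $Q^{(\alpha)}_{n-m,n-m}(x;-1)f(1)$. The Ditzian-Totik modulus of smoothness is $$\omega_{\phi^\beta}(f;\delta)=\sup_{0\le h\le\delta}\ \sup_{y\pm h\phi^\beta(y)/2\in[0,\infty)}\left|f\!\left(y+\tfrac{h\phi^\beta(y)}{2}\right)-f\!\left(y-\tfrac{h\phi^\beta(y)}{2}\right)\right|,$$ where $\phi^\beta(y)=(\phi(y))^\beta$. *)

(* Defs.v *)
From HB Require Import structures.
From mathcomp Require Import all_boot all_order all_algebra.
From mathcomp Require Import all_classical all_reals all_analysis.

Set Implicit Arguments.
Unset Strict Implicit.
Unset Printing Implicit Defensive.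

Import Order.TTheory GRing.Theory Num.Theory.
Import numFieldNormedType.Exports.

Local Open Scope classical_set_scope.
Local Open Scope ring_scope.

(* The parameter c ranges over the integers c >= -1. The underlying interval
   is [0, 1] in the Bernstein case c = -1, where sqrt (x (1 + c x)) is real
   only on [0, 1], and [0, +oo[ otherwise. *)
Definition domain (R : realType) (c : int) : set R :=
  if c == -1 then `[0, 1]%classic else `[0, +oo[%classic.

(* Only the restriction of f to D is constrained. *)
Definition continuous_bounded (R : realType) (D : set R) (f : R -> R) : Prop :=
  {within D, continuous f} /\ [bounded f x | x in D].

Definition weight (R : realType) (c : int) (x : R) : R :=
  Num.sqrt (x * (1 + c%:~R * x)).

(* N is an integer because it is instantiated with n + m c and
   n + (m + 2) c, where m may be negative. *)
Definition phi (R : realType) (c N : int) (x : R) : R :=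
  if c == 0 then expR (- N%:~R * x)
  else if c == -1 then (1 - x) ^ N
  else (1 + c%:~R * x) `^ (- (N%:~R / c%:~R)).

Definition basis_fun (R : realType) (c N : int) (k : nat) (x : R) : R :=
  (- x) ^+ k / (k`!)%:R * derive1n k (@phi R c N) x.

Definition tail (R : realType) (c N : int) (k : nat) (x : R) : R :=
  limn (fun K => \sum_(k <= j < K) basis_fun c N j x).

Definition bezier (R : realType) (c : int) (alpha : R) (N : int) (k : nat)
    (x : R) : R :=
  tail c N k x `^ alpha - tail c N k.+1 x `^ alpha.

(* k-th summand (k >= 1) of the operator, without the factor n + (m + 1) c. *)
Definition durrmeyer_term (R : realType) (c m : int) (alpha : R) (n : nat)
    (f : R -> R) (x : R) (k : nat) : R :=
  bezier c alpha (n%:Z + m * c) k x *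
  \int[lebesgue_measure]_(t in domain c)
    (basis_fun c (n%:Z + (m + 2) * c) k.-1 t * f t).

(* For c = -1 the natural number `|n - m| is n - m as soon as n >= m. *)
Definition durrmeyer (R : realType) (c m : int) (alpha : R) (n : nat)
    (f : R -> R) (x : R) : R :=
  let rho : R := (n%:Z + (m + 1) * c)%:~R in
  let term := durrmeyer_term c m alpha n f x in
  let head := bezier c alpha (n%:Z + m * c) 0 x * f 0 in
  if c == -1 then
    let d := `|n%:Z - m|%N in
    rho * (\sum_(1 <= k < d) term k) + head
    + bezier c alpha (n%:Z - m) d x * f 1
  else rho * limn (fun K => \sum_(1 <= k < K) term k) + head.

(* As `domain c` is convex, y itself lies in it, so the weight is always
   evaluated inside its domain. Here 0 `^ 0 = 1 and 0 `^ beta = 0 for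
   beta != 0. *)
Definition ditzian_totik (R : realType) (c : int) (beta : R) (f : R -> R)
    (delta : R) : R :=
  sup [set w | exists h y : R,
    let s := h * weight c y `^ beta / 2 in
    [/\ 0 <= h <= delta, domain c (y + s), domain c (y - s) &
        w = `|f (y + s) - f (y - s)|]].

(* Main.v *)
Require Import Defs.
From HB Require Import structures.
From mathcomp Require Import all_boot all_order all_algebra.
From mathcomp Require Import all_classical all_reals all_analysis.
From mathcomp Require Import measurable_realfun ring lra zify.

(* Write [p_(N,k)] for the basis functions and [N = n + m c]. From
   [phi_N' = - N phi_(N+c)] one gets [p_(N,k)' = N (p_(N+c,k-1) - p_(N+c,k))],
   so that the partial sums of the [p_(N,k)] have a single basis function as
   derivative. This yields [sum_k p_(N,k) = 1] and
   [M * int p_(M+c,k) = 1], and, since multiplication by [t] or by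
   [(1 + c t)^-1] only shifts the indices of the basis functions, all moments
   below, uniformly in [c]. For [alpha = 1] the operator has second central
   moment [2 phi(x)^2 / (N - c)], and the Bezier weights are at most [alpha]
   times the weights for [alpha = 1].
   For the modulus, one step from [u] to [v] is allowed as soon as [|u - v|] is
   at most the minimum of the weights at [x] and at the midpoint, divided by
   [sqrt n]. Walking from [t] to [x] with equal steps, in the coordinate
   [sqrt u] when [t < x], bounds [|f t - f x|] by the modulus times
   [2 + 2 n (t - x)^2 / phi(x)^2 + (1 + c x) / (1 + c t)], and it remains to
   average over [t]. *)

Import Order.TTheory GRing.Theory Num.Theory.
Import numFieldNormedType.Exports.

Local Open Scope classical_set_scope.
Local Open Scope ring_scope.

Definition admissible (c : int) := c = -1 \/ 0 <= c.

(* Near these points the derivatives of [phi] are given by one formula; for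
   [0 < c] and [1 + c x < 0], [powR] is constantly [1]. *)
Definition regular {R : realType} (c : int) (x : R) :=
  (c == -1) || (0 < 1 + c%:~R * x).

Lemma is_derive_continuous {R : realType} (f : R -> R) (x d : R) :
  is_derive x 1 f d -> {for x, continuous f}.
Proof. by case=> df _; exact/differentiable_continuous/derivable1_diffP. Qed.

(** * Derivatives of [phi] and of the basis functions *)

Section phi_derivatives.
Context {R : realType}.
Implicit Types (c M : int) (x : R).

Lemma is_derive_phi c M x : admissible c -> 0 <= M -> regular c x ->
  is_derive x 1 (@phi R c M) (- M%:~R * phi c (M + c) x).
Proof.
move=> hc M0 rx; rewrite /phi.
have [c0|c0] := eqVneq c 0.
  subst c; rewrite addr0.
  have -> : (fun x : R => expR (- M%:~R * x)) = expR \o (fun x => - M%:~R * x) by [].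
  apply: is_derive_eq; rewrite /= /GRing.scale /=; ring.
have [c1|c1] := eqVneq c (-1).
  subst c; case: M M0 => // -[|k] _.
    under eq_fun do rewrite expr0z.
    by apply: is_derive_eq; rewrite oppr0 mul0r.
  have -> : (k.+1%:Z + -1 = k%:Z) by lia.
  under eq_fun do rewrite exprSz -exprnP -exprS.
  rewrite -exprnP.
  have -> : (fun y : R => (1 - y) ^+ k.+1) = (cst 1 - id) ^+ k.+1.
    by apply/funext => y; rewrite exprfctE.
  by apply: is_derive_eq; rewrite /GRing.scale /= sub0r mulrN1 mulNr.
have cp : (0 < c%:~R :> R) by rewrite ltr0z; case: hc; lia.
move: rx; rewrite /regular (negPf c1) /= => rx.
have dg : is_derive x 1 (cst 1 + c%:~R \*: id) c%:~R.
  by apply: is_derive_eq; rewrite /GRing.scale /= mulr1 add0r.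
rewrite -[fun x : R => _]/((@powR R ^~ (- (M%:~R / c%:~R))) \o (cst 1 + c%:~R \*: id)).
have dp := is_derive1_powR (- (M%:~R / c%:~R)) rx.
apply: is_derive_eq; rewrite /cst /=; rewrite rmorphD /= mulrDl divff ?gt_eqF//.
rewrite opprD; field.
by rewrite gt_eqF.
Qed.

Lemma regular_nbhs c x : regular c x -> \forall y \near x, regular c y.
Proof.
rewrite /regular => /orP[c1|h]; first by near=> y; rewrite c1.
have d : is_derive x 1 (cst 1 + c%:~R \*: id) (0 + c%:~R *: 1) by apply: is_derive_eq.
have /cvgr_gt/(_ _ h) := is_derive_continuous _ _ _ d.
by apply: filterS => y /= ->; rewrite orbT.
Unshelve. all: by end_near. Qed.

(** The coefficient that [k] differentiations of [phi] bring out: a rising factorial with increment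
    [c]. It is the power [M ^ k] for [c = 0] and a falling factorial for [c = -1], where it vanishes
    once [k] exceeds [M >= 0]. *)
Definition rising c M k : int := \prod_(i < k) (M + i%:Z * c).

Lemma rising_eq0 M k : 0 <= M -> M < k%:Z -> rising (-1) M k = 0.
Proof.
move=> M0 Mk; apply/eqP/prodf_eq0.
have h : (`|M| < k)%N by lia.
by exists (Ordinal h) => //=; apply/eqP; lia.
Qed.

Lemma rising_ge0 c M k : admissible c -> 0 <= M -> 0 <= rising c M k.
Proof.
move=> hc M0; case: hc => [->|c0]; last first.
  by apply: prodr_ge0 => i _; rewrite addr_ge0// mulr_ge0.
have [kM|Mk] := leP k%:Z M; last by rewrite rising_eq0.
by apply: prodr_ge0 => i _; have := ltn_ord i; lia.
Qed.

Lemma risingS c M k : rising c M k.+1 = rising c M k * (M + k%:Z * c).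
Proof. by rewrite /rising big_ord_recr. Qed.

Lemma risingSl c M k : rising c M k.+1 = M * rising c (M + c) k.
Proof.
rewrite /rising big_ord_recl mul0r addr0; congr (_ * _).
by apply: eq_bigr => i _ /=; rewrite /bump /=; lia.
Qed.

Lemma is_derive_rising_phi c M k x : admissible c -> 0 <= M -> regular c x ->
  is_derive x 1
    (fun y : R => (-1) ^+ k * (rising c M k)%:~R * phi c (M + k%:Z * c) y)
    ((-1) ^+ k.+1 * (rising c M k.+1)%:~R * phi c (M + k.+1%:Z * c) x).
Proof.
(* For [c = -1] the index [M + k c] can become negative, beyond the reach of [is_derive_phi]; the
   coefficient is zero in that case. *)
move=> hc M0 rx; have [r0|r0] := eqVneq (rising c M k) 0.
  under eq_fun do rewrite r0 mulr0 mul0r.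
  rewrite risingS r0 mul0r mulr0 mul0r. exact: is_derive_cst.
have Mk : 0 <= M + k%:Z * c.
  case: hc => [c1|c0]; last by rewrite addr_ge0// mulr_ge0.
  subst c; have [|h] := leP k%:Z M; first lia.
  by move: r0; rewrite rising_eq0 ?eqxx.
have dphi := is_derive_phi c _ x hc Mk rx.
set a := (_ * _%:~R); rewrite -[fun x => _]/(a \*: phi c (M + k%:Z * c)).
apply: is_derive_eq; rewrite /GRing.scale /=.
rewrite risingS /a exprS !rmorphM /= -addrA (_ : k%:Z * c + c = k.+1%:Z * c); last lia.
ring.
Qed.

Lemma derive1n_phi c M k x : admissible c -> 0 <= M -> regular c x ->
  derive1n k (@phi R c M) x =
    (-1) ^+ k * (rising c M k)%:~R * phi c (M + k%:Z * c) x.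
Proof.
move=> hc M0; elim: k x => [|k ih] x rx.
  by rewrite /rising big_ord0 !mul1r mul0r addr0.
rewrite derive1nS derive1E.
(* A derivative depends on a whole neighbourhood, so the induction hypothesis is applied at the
   nearby points, which are regular too. *)
have e : \near x, derive1n k (@phi R c M) x =
    (-1) ^+ k * (rising c M k)%:~R * phi c (M + k%:Z * c) x.
  by have := regular_nbhs _ _ rx; apply: filterS => y; exact: ih.
rewrite (near_eq_derive _ e).
by apply: derive_val; exact: is_derive_rising_phi.
Qed.

Lemma is_derive_derive1n_phi c M k x :
  admissible c -> 0 <= M -> regular c x ->
  is_derive x 1 (derive1n k (@phi R c M)) (derive1n k.+1 (@phi R c M) x).
Proof.
move=> hc M0 rx; rewrite derive1n_phi//.
apply: near_eq_is_derive (is_derive_rising_phi c M k x hc M0 rx).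
have := regular_nbhs _ _ rx; apply: filterS => y ry.
by rewrite derive1n_phi.
Qed.

Lemma basis_funE c M k x : admissible c -> 0 <= M -> regular c x ->
  basis_fun c M k x =
    (rising c M k)%:~R / (k`!)%:R * x ^+ k * phi c (M + k%:Z * c) x.
Proof.
move=> hc M0 rx; rewrite /basis_fun derive1n_phi// (exprNn x).
move: (sqrr_sign R k); move: ((-1) ^+ k) => s h.
rewrite [LHS](_ : _ = s ^+ 2 * ((rising c M k)%:~R / (k`!)%:R * x ^+ k *
   phi c (M + k%:Z * c) x)); last by rewrite expr2; field; rewrite pnatr_eq0 -lt0n fact_gt0.
by rewrite h mul1r.
Qed.

Lemma derive1n_phiS c M k x : admissible c -> 0 <= M -> regular c x ->
  derive1n k.+1 (@phi R c M) x = - M%:~R * derive1n k (@phi R c (M + c)) x.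
Proof.
move=> hc M0 rx.
(* [M = 0] is treated apart because [M + c] is then negative for [c = -1]; both sides vanish. *)
have [M00|M00] := eqVneq M 0.
  by rewrite derive1n_phi// risingSl M00 mul0r mulr0 mul0r oppr0 mul0r.
have Mc : 0 <= M + c by case: hc => [->|]; lia.
rewrite !derive1n_phi// risingSl exprS rmorphM /=.
rewrite -addrA (_ : c + k%:Z * c = k.+1%:Z * c); last lia.
ring.
Qed.

Lemma is_derive_basis_fun0 c M x : admissible c -> 0 <= M -> regular c x ->
  is_derive x 1 (@basis_fun R c M 0) (- (M%:~R * basis_fun c (M + c) 0 x)).
Proof.
move=> hc M0 rx; have := is_derive_phi c M x hc M0 rx.
rewrite (_ : basis_fun c M 0 = phi c M); last first.
  by apply/funext => y; rewrite /basis_fun expr0 fact0 divr1 mul1r.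
by rewrite /basis_fun expr0 fact0 divr1 mul1r mulNr.
Qed.

Lemma is_derive_basis_funS c M k x : admissible c -> 0 <= M -> regular c x ->
  is_derive x 1 (@basis_fun R c M k.+1)
    (M%:~R * (basis_fun c (M + c) k x - basis_fun c (M + c) k.+1 x)).
Proof.
move=> hc M0 rx.
have dd := is_derive_derive1n_phi c M k.+1 x hc M0 rx.
have -> : @basis_fun R c M k.+1 =
    ((k.+1)`!%:R^-1 \*: (- id) ^+ k.+1) * derive1n k.+1 (@phi R c M).
  by apply/funext => y; rewrite /basis_fun !fctE /GRing.scale /= [_ / _]mulrC.
apply: is_derive_eq; rewrite ?fctE /GRing.scale /= /basis_fun.
rewrite -!derive1nS !(derive1n_phiS c M) // factS natrM [in LHS]exprS /GRing.scale /= exprS.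
field.
by rewrite nat1r !pnatr_eq0 -lt0n fact_gt0.
Qed.
End phi_derivatives.

(** * The basis functions as a partition of unity *)

Section basis_mass.
Context {R : realType}.
Implicit Types (c M : int) (x y : R).

Lemma domain_ge0 c x : domain c x -> 0 <= x.
Proof. by rewrite /domain; case: ifP => _ /=; rewrite in_itv /= => /andP[]. Qed.

Lemma domain_ge1 c x : domain c x -> c = -1 -> x <= 1.
Proof. by rewrite /domain => /[swap] ->; rewrite eqxx /= in_itv /= => /andP[]. Qed.

Lemma domain_ball c x y : domain c x -> 0 <= y -> y <= x -> domain c y.
Proof.
rewrite /domain; case: ifP => _ /=; rewrite !in_itv /=; last by move=> _ ->.
by move=> /andP[_ x1] -> /le_trans->.
Qed.

Lemma domain0 c : domain c (0 : R).
Proof. by rewrite /domain; case: ifP => _ /=; rewrite in_itv /= lexx ?ler01. Qed.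

Lemma domain_regular c x : admissible c -> domain c x -> regular c x.
Proof.
move=> hc dx; rewrite /regular; case: eqP => //= c1.
rewrite ltr_pwDl// mulr_ge0 ?(domain_ge0 _ _ dx)// ler0z.
by case: hc.
Qed.

Lemma domain_factor_ge0 c x : admissible c -> domain c x -> 0 <= 1 + c%:~R * x.
Proof.
move=> hc dx; have := domain_regular _ _ hc dx; rewrite /regular.
case/orP => [/eqP c1|/ltW//].
by have := domain_ge1 _ _ dx c1; rewrite c1 /=; lra.
Qed.

Lemma phi_ge0 c M x : admissible c -> domain c x -> 0 <= phi c M x.
Proof.
move=> hc dx; rewrite /phi; case: ifP => _; first exact: expR_ge0.
case: ifP => [/eqP c1|_]; last exact: powR_ge0.
by apply: exprz_ge0; have := domain_ge1 _ _ dx c1; lra.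
Qed.

Lemma basis_fun_ge0 c M k x : admissible c -> 0 <= M -> domain c x ->
  0 <= basis_fun c M k x.
Proof.
move=> hc M0 dx; rewrite basis_funE//; last exact: domain_regular.
rewrite !mulr_ge0// ?phi_ge0 ?exprn_ge0 ?(domain_ge0 _ _ dx) ?invr_ge0//.
by rewrite ler0z rising_ge0.
Qed.

Lemma basis_fun_at0 c M k : admissible c -> 0 <= M ->
  basis_fun c M k (0 : R) = (k == 0%N)%:R.
Proof.
move=> hc M0; case: k => [|k]; last by rewrite /basis_fun oppr0 exprS !mul0r.
rewrite /basis_fun expr0 fact0 divr1 mul1r /derive1n /= /phi !mulr0 expR0 addr0.
by rewrite powR1 subr0 exp1rz; do !case: ifP.
Qed.

Lemma basis_fun_gt c M k x : admissible c -> domain c x -> c = -1 -> 0 <= M ->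
  M < k%:Z -> basis_fun c M k x = 0.
Proof.
move=> hc dx c1 M0 Mk; rewrite basis_funE//; last exact: domain_regular.
by rewrite c1 rising_eq0// !mul0r.
Qed.

Lemma basis_fun_at1 M k : 0 <= M -> k%:Z < M -> basis_fun (-1) M k (1 : R) = 0.
Proof.
move=> M0 kM; rewrite basis_funE//; last by left.
rewrite /phi /= subrr exp0rz.
by rewrite (_ : (_ == 0) = false) ?mulr0//; lia.
Qed.

Lemma basis_funS c M k x : admissible c -> 0 <= M -> regular c x ->
  k.+1%:R * basis_fun c M k.+1 x = M%:~R * x * basis_fun c (M + c) k x.
Proof.
move=> hc M0 rx; rewrite /basis_fun (derive1n_phiS c M)// factS natrM exprS.
field.
by rewrite nat1r !pnatr_eq0 -lt0n fact_gt0.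
Qed.

Lemma phi_shift c M x : 0 <= c -> regular c x ->
  (1 + c%:~R * x) * phi c (M + c) x = phi c M x.
Proof.
move=> c0; rewrite /regular /phi.
have -> : (c == -1) = false by lia.
move=> /= rx; have [->|cn0] := eqVneq c 0; first by rewrite mul0r addr0 mul1r addr0.
have -> : - ((M + c)%:~R / c%:~R : R) = - (M%:~R / c%:~R) - 1.
  by rewrite rmorphD /=; field; rewrite intr_eq0.
rewrite powRD; last by apply/implyP => _; rewrite gt_eqF.
rewrite -[X in X * _]powRr1 ?ltW// mulrCA -powRD; last by apply/implyP => _; rewrite gt_eqF.
by rewrite subrr powRr0 mulr1.
Qed.

(** The products [M * rising c (M + c) k] and [rising c M k * (M + k c)] both equal
    [rising c M k.+1], while [phi_shift] absorbs the factor [1 + c x]. *)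
Lemma basis_fun_shift c M k x : 0 <= c -> 0 <= M -> regular c x ->
  (1 + c%:~R * x) * (M%:~R * basis_fun c (M + c) k x) =
  (M%:~R + k%:R * c%:~R) * basis_fun c M k x.
Proof.
move=> c0 M0 rx; have hc : admissible c by right.
rewrite !basis_funE//; last exact: addr_ge0.
rewrite -(phi_shift c (M + k%:Z * c))// [M + c + _]addrAC.
have : (M * rising c (M + c) k)%:~R = (rising c M k * (M + k%:Z * c))%:~R :> R.
  by rewrite -risingSl risingS.
rewrite !rmorphM rmorphD rmorphM /= => e.
transitivity ((M%:~R * (rising c (M + c) k)%:~R) / k`!%:R * x ^+ k *
   ((1 + c%:~R * x) * phi c (M + k%:Z * c + c) x)); first by ring.
by rewrite e; ring.
Qed.

Definition mass c M K x := \sum_(k < K) basis_fun c M k x.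

Lemma massS c M K x : mass c M K.+1 x = mass c M K x + basis_fun c M K x.
Proof. by rewrite /mass big_ord_recr. Qed.

Lemma mass0 c M x : mass c M 0 x = 0.
Proof. by rewrite /mass big_ord0. Qed.

Lemma is_derive_mass c M K x : admissible c -> 0 <= M -> regular c x ->
  is_derive x 1 (mass c M K.+1) (- (M%:~R * basis_fun c (M + c) K x)).
Proof.
move=> hc M0 rx; elim: K => [|K ih].
  rewrite (_ : mass c M 1 = basis_fun c M 0); first exact: is_derive_basis_fun0.
  by apply/funext => y; rewrite massS mass0 add0r.
rewrite (_ : mass c M K.+2 = mass c M K.+1 + basis_fun c M K.+1); last first.
  by apply/funext => y; rewrite massS.
have := is_derive_basis_funS c M K x hc M0 rx => h.
by apply: is_derive_eq; ring.
Qed.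

Lemma mass_at0 c M K : admissible c -> 0 <= M -> mass c M K.+1 (0 : R) = 1.
Proof.
move=> hc M0; rewrite /mass big_ord_recl /= basis_fun_at0//= big1 ?addr0// => i _.
by rewrite basis_fun_at0.
Qed.

(** Serves to carry to [x] the comparisons that are explicit at [0], where all basis functions but
    the first vanish. The domain contains the whole segment between the two points. *)
Lemma le_derive_domain c (f df : R -> R) x : admissible c ->
  (forall y, domain c y -> is_derive y 1 f (df y)) ->
  (forall y, domain c y -> 0 <= df y) -> domain c x -> f 0 <= f x.
Proof.
move=> hc fdf df0 dx; have x0 := domain_ge0 _ _ dx.
have din y : 0 <= y <= x -> domain c y by move=> /andP[]; exact: domain_ball.
apply: (@ger0_derive1_ndecr _ f 0 x) => // [y yx|y yx|].
- have /fdf [] // : domain c y.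
  by apply: din; move: yx; rewrite in_itv /= => /andP[/ltW -> /ltW ->].
- have dy : domain c y.
    by apply: din; move: yx; rewrite in_itv /= => /andP[/ltW -> /ltW ->].
  by rewrite derive1E; have [_ ->] := fdf _ dy; exact: df0.
- apply: continuous_in_subspaceT => y; rewrite inE /= in_itv /= => /din /fdf.
  exact: is_derive_continuous.
Qed.

Lemma basis_fun_shift_ge0 c M k x : admissible c -> 0 <= M -> domain c x ->
  0 <= M%:~R * basis_fun c (M + c) k x.
Proof.
(* The factor [M] removes the case [M = 0], in which [M + c] would be negative for [c = -1]. *)
move=> hc M0 dx; have [->|Mn0] := eqVneq M 0; first by rewrite mul0r.
by apply: mulr_ge0; rewrite ?ler0z//; apply: basis_fun_ge0 => //; case: hc; lia.
Qed.

Lemma mass_ge0 c M K x : admissible c -> 0 <= M -> domain c x -> 0 <= mass c M K x.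
Proof. by move=> hc M0 dx; apply: sumr_ge0 => i _; exact: basis_fun_ge0. Qed.

Lemma mass_le1 c M K x : admissible c -> 0 <= M -> domain c x -> mass c M K x <= 1.
Proof.
move=> hc M0 dx; case: K => [|K]; first by rewrite mass0.
rewrite -(mass_at0 c M K hc M0) -lerN2.
apply: (le_derive_domain c (- mass c M K.+1)
  (fun y => M%:~R * basis_fun c (M + c) K y)) => // y dy; last first.
  exact: basis_fun_shift_ge0.
have := is_derive_mass c M K y hc M0 (domain_regular _ _ hc dy) => h.
by apply: is_derive_eq; rewrite opprK.
Qed.

Lemma basis_fun_le1 c M k x : admissible c -> 0 <= M -> domain c x ->
  basis_fun c M k x <= 1.
Proof.
move=> hc M0 dx; apply: le_trans (mass_le1 c M k.+1 x hc M0 dx).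
by rewrite massS lerDr mass_ge0.
Qed.

Lemma shift_mass_le c M K x : admissible c -> 0 <= M -> domain c x ->
  M%:~R * mass c (M + c) K x <= M%:~R.
Proof.
move=> hc M0 dx; have [->|Mn0] := eqVneq M 0; first by rewrite mul0r.
by apply: ler_piMr; rewrite ?ler0z//; apply: mass_le1 => //; case: hc; lia.
Qed.

(* The mass deficits [1 - mass k], [1 <= k <= K], add up to a function of [x]
   with derivative [M * mass (M + c) K <= M], hence to at most [M x]. *)
Lemma sum_deficit_le c M K x : admissible c -> 0 <= M -> domain c x ->
  \sum_(k < K) (1 - mass c M k.+1 x) <= M%:~R * x.
Proof.
move=> hc M0 dx.
pose G (y : R) := M%:~R * y - \sum_(k < K) (1 - mass c M k.+1 y).
suff : G 0 <= G x.
  rewrite /G mulr0 big1 ?subr0 ?subr_ge0// => i _.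
  by rewrite mass_at0// subrr.
apply: (le_derive_domain c G (fun y => M%:~R - M%:~R * mass c (M + c) K y)) => // y dy.
  have d (k : 'I_K) : is_derive y 1 (cst 1 - mass c M k.+1) (M%:~R * basis_fun c (M + c) k y).
    have := is_derive_mass c M k y hc M0 (domain_regular _ _ hc dy) => h.
    by apply: is_derive_eq; rewrite sub0r opprK.
  have -> : G = M%:~R \*: id - \sum_(k < K) (cst 1 - mass c M k.+1).
    by apply/funext => z; rewrite /G !fctE fct_sumE.
  by apply: is_derive_eq; rewrite /GRing.scale /= mulr1 /mass mulr_sumr.
by rewrite subr_ge0 shift_mass_le.
Qed.

(** The deficits do not increase with the index, so [K] times the last one is at most their sum.
    This is Markov's inequality for the index, and it makes [mass] converge to [1]. *)
Lemma deficit_le c M K x : admissible c -> 0 <= M -> domain c x ->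
  K%:R * (1 - mass c M K x) <= M%:~R * x.
Proof.
move=> hc M0 dx; apply: le_trans (sum_deficit_le c M K x hc M0 dx).
rewrite mulr_natl -[K in _ *+ K]card_ord -sumr_const; apply: ler_sum => i _.
rewrite lerD2l lerN2 /mass -!(big_mkord xpredT (fun k => basis_fun c M k x)).
rewrite [leRHS](@big_cat_nat _ _ _ i.+1)//= lerDl.
by apply: sumr_ge0 => j _; exact: basis_fun_ge0.
Qed.

Lemma mass_cvg c M x : admissible c -> 0 <= M -> domain c x ->
  (fun K => mass c M K x) @ \oo --> (1 : R).
Proof.
move=> hc M0 dx; apply/cvgrPdist_le => e e0.
near=> K.
have K0 : (0 < K)%N by near: K; exact: nbhs_infty_gt.
rewrite ger0_norm ?subr_ge0 ?mass_le1//.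
have := deficit_le c M K x hc M0 dx.
rewrite mulrC -ler_pdivlMr ?ltr0n// => /le_trans; apply.
have Ke : M%:~R * x / e <= K%:R by near: K; exact: nbhs_infty_ger.
by rewrite ler_pdivrMr ?ltr0n// [e * _]mulrC -ler_pdivrMr.
Unshelve. all: by end_near. Qed.

Lemma tailE c M k x : admissible c -> 0 <= M -> domain c x ->
  tail c M k x = 1 - mass c M k x.
Proof.
move=> hc M0 dx; rewrite /tail; apply/cvg_lim => //.
have : (fun K => mass c M K x - mass c M k x) @ \oo --> 1 - mass c M k x.
  by apply: cvgB; [exact: mass_cvg|exact: cvg_cst].
apply: cvg_trans; apply: near_eq_cvg; near=> K.
have kK : (k <= K)%N by near: K; exact: nbhs_infty_ge.
rewrite /mass -!(big_mkord xpredT (fun k => basis_fun c M k x)).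
by rewrite [X in X - _](@big_cat_nat _ _ _ k)//= addrAC subrr add0r.
Unshelve. all: by end_near. Qed.

End basis_mass.

(** * Integrals of the basis functions *)

Section basis_integral.
Context {R : realType}.
Implicit Types (c M : int) (x y : R).
Local Notation mu := (@lebesgue_measure R).

Lemma measurable_domain c : measurable (domain c : set (measurableTypeR R)).
Proof. by rewrite /domain; case: ifP => _; exact: measurable_itv. Qed.

Lemma continuous_basis_fun c M k x : admissible c -> 0 <= M -> regular c x ->
  {for x, continuous (@basis_fun R c M k)}.
Proof.
move=> hc M0 rx; case: k => [|k]; apply: is_derive_continuous.
  exact: is_derive_basis_fun0.
exact: is_derive_basis_funS.
Qed.

Lemma within_continuous_basis_fun c M k : admissible c -> 0 <= M ->
  {within domain c, continuous (@basis_fun R c M k)}.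
Proof.
move=> hc M0; apply: continuous_in_subspaceT => y; rewrite inE => dy.
by apply: continuous_basis_fun => //; exact: domain_regular.
Qed.

(** By [basis_funS] at the parameter [M - c], the product [(M - c) x p_(M,k)(x)] equals
    [(k + 1) p_(M-c,k+1)(x)], which is at most [k + 1]; hence the decay is at least of order
    [1 / x]. *)
Lemma basis_fun_cvg_infty c M k : 0 <= c -> c < M ->
  basis_fun c M k x @[x --> +oo] --> (0 : R).
Proof.
move=> c0 cM; have hc : admissible c by right.
have Mc : 0 < M - c by rewrite subr_gt0.
apply/cvgrPdist_le => e e0; near=> x.
have x0 : 0 < x by near: x; exact: nbhs_pinfty_gt.
have dx : domain c x.
  by rewrite /domain (_ : (c == -1) = false) /= ?in_itv /= ?ltW//; lia.
have M0 : 0 <= M by lia.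
rewrite sub0r normrN ger0_norm ?basis_fun_ge0//.
have := basis_funS c (M - c) k x hc (ltW Mc) (domain_regular _ _ hc dx).
rewrite subrK => h.
have Mcx : 0 < (M - c)%:~R * x by rewrite mulr_gt0// ltr0z.
rewrite -(ler_pM2l Mcx) -h.
apply: (@le_trans _ _ k.+1%:R).
  by rewrite ler_piMr// basis_fun_le1// ltW.
rewrite [_ * x]mulrC -mulrA -ler_pdivrMr; last by rewrite mulr_gt0// ltr0z.
near: x; apply: nbhs_pinfty_ge; exact: num_real.
Unshelve. all: by end_near. Qed.

Lemma mass_cvg_infty c M K : 0 <= c -> c < M ->
  mass c M K x @[x --> +oo] --> (0 : R).
Proof.
move=> c0 cM; elim: K => [|K ih].
  by under eq_fun do rewrite mass0; exact: cvg_cst.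
have -> : mass c M K.+1 = mass c M K + basis_fun c M K :> (R -> R).
  by apply/funext => y; rewrite massS.
have := cvgD ih (basis_fun_cvg_infty c M K c0 cM); rewrite addr0; apply.
Qed.

(* [- M^-1 * mass c M k.+1] is a primitive of [basis_fun c (M + c) k]. *)
Lemma integral_basis_fun c M k : admissible c -> 0 < M ->
  (0 <= c -> c < M) -> (c = -1 -> k%:Z < M) ->
  (\int[mu]_(t in domain c) (basis_fun c (M + c) k t)%:E = (M%:~R^-1)%:E)%E.
Proof.
move=> hc M0 cM kM.
have Mn0 : M%:~R != 0 :> R by rewrite intr_eq0; lia.
have Mc0 : 0 <= M + c by case: hc; lia.
pose F : R -> R := - M%:~R^-1 \*: mass c M k.+1.
have dF x : regular c x -> is_derive x 1 F (basis_fun c (M + c) k x).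
  move=> rx; have := is_derive_mass c M k x hc (ltW M0) rx => h.
  by apply: is_derive_eq; rewrite /GRing.scale /= mulrNN mulKf.
have cF x : regular c x -> {for x, continuous F}.
  by move=> /dF; exact: is_derive_continuous.
have F0 : F 0 = - M%:~R^-1 by rewrite /F /= /GRing.scale /= mass_at0 ?mulr1// ltW.
have r0 : regular c (0 : R) by apply: domain_regular => //; exact: domain0.
have wc := within_continuous_basis_fun c (M + c) k hc Mc0.
case: (hc) => c1.
  have r (x : R) : regular c x by rewrite /regular c1.
  rewrite /domain c1 eqxx -c1.
  rewrite (@continuous_FTC2 _ _ F)//.
  (* At [1] every basis function in the sum has index below [M] and vanishes, so only [F 0]
     contributes. *)
  - rewrite F0 /F /= /GRing.scale /= /mass big1 ?mulr0 -?EFinB ?sub0r ?opprK// => i _.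
    rewrite c1 basis_fun_at1 ?ltW//; have := ltn_ord i; have := kM c1; lia.
  - by move: wc; rewrite /domain c1 eqxx.
  - split; first by move=> x _; case: (dF x (r x)).
    + by apply: cvg_at_right_filter; exact: cF.
    + by apply: cvg_at_left_filter; exact: cF.
  - by move=> x _; rewrite derive1E; case: (dF x (r x)).
have cn : (c == -1) = false by lia.
have dom (x : R) : domain c x <-> 0 <= x.
  by rewrite /domain cn /= in_itv /= andbT.
have r (x : R) : 0 <= x -> regular c x.
  by move=> x0; apply: domain_regular => //; apply/dom.
rewrite (_ : domain c = `[0, +oo[%classic); last by rewrite /domain cn.
rewrite (@ge0_continuous_FTC2y _ _ F 0 0)//.
- by rewrite F0 -EFinB sub0r opprK.
- by move=> x /dom; exact: basis_fun_ge0.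
- by move: wc; rewrite /domain cn.
- rewrite /F /= -(mulr0 (- M%:~R^-1)); apply: cvgM; first exact: cvg_cst.
  by apply: mass_cvg_infty => //; exact: cM.
- by move=> x /ltW /r /dF [].
- by apply: cvg_at_right_filter; exact: cF.
- move=> x; rewrite in_itv /= andbT => /ltW /r /dF d.
  by rewrite derive1E; case: d.
Qed.

Lemma integrable_basis_fun c M k : admissible c -> 0 < M ->
  (0 <= c -> c < M) -> (c = -1 -> k%:Z < M) ->
  mu.-integrable (domain c) (EFin \o basis_fun c (M + c) k).
Proof.
move=> hc M0 cM kM; have Mc0 : 0 <= M + c by case: hc; lia.
apply/integrableP; split.
  apply/measurable_EFinP; apply: subspace_continuous_measurable_fun.
    exact: measurable_domain.
  exact: within_continuous_basis_fun.
under eq_integral => t.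
  rewrite inE => dt; rewrite /= ger0_norm ?basis_fun_ge0//; over.
by rewrite integral_basis_fun// ltry.
Qed.

Lemma Rintegral_basis_fun c M k : admissible c -> 0 < M ->
  (0 <= c -> c < M) -> (c = -1 -> k%:Z < M) ->
  \int[mu]_(t in domain c) basis_fun c (M + c) k t = M%:~R^-1.
Proof. by move=> *; rewrite /Rintegral integral_basis_fun. Qed.

Lemma integrable_basis_mul c M k (f : R -> R) : admissible c -> 0 < M ->
  (0 <= c -> c < M) -> (c = -1 -> k%:Z < M) ->
  continuous_bounded (domain c) f ->
  mu.-integrable (domain c) (EFin \o (fun t => basis_fun c (M + c) k t * f t)).
Proof.
move=> hc M0 cM kM [cf bf].
have mf : measurable_fun (domain c : set (measurableTypeR R)) (f : _ -> measurableTypeR R).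
  by apply: subspace_continuous_measurable_fun => //; exact: measurable_domain.
have := integrableMl (measurable_domain c)
  (integrable_basis_fun c M k hc M0 cM kM) mf bf.
by apply: eq_integrable; [exact: measurable_domain|move=> t _; rewrite /= EFinM].
Qed.

End basis_integral.

(** * The averages of [f] inside the operator *)

Section durrmeyer_mean.
Context {R : realType}.
Implicit Types (c M N : int) (x y : R).
Local Notation mu := (@lebesgue_measure R).

(** With [N = n + m c], the factor [N + c] is the operator's [n + (m + 1) c]. It is also the
    reciprocal of the integral of the basis function, so that this is an average of [f] against a
    probability density. *)
Definition durrmeyer_mean c N k (f : R -> R) : R :=
  (N + c)%:~R * \int[mu]_(t in domain c) (basis_fun c (N + 2 * c) k.-1 t * f t).

(* The closed forms of the [k]-th mean of [(t - x) ^+ 2] and of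
   [(1 + c t)^-1]; for [c = -1] no inverse factor is needed, hence the [0]. *)
Definition second_moment c N (k : nat) x : R :=
  k%:R * k.+1%:R / (N%:~R * (N - c)%:~R) - 2 * x * (k%:R / N%:~R) + x ^+ 2.

Definition inverse_factor c x : R :=
  if c == -1 then 0 else (1 + c%:~R * x)^-1.

Definition inverse_moment c N (k : nat) : R :=
  if c == -1 then 0 else (N + c)%:~R / (N + c + k%:Z * c)%:~R.

Lemma integrable_lin c (f g : R -> R) (a : R) :
  mu.-integrable (domain c) (EFin \o f) -> mu.-integrable (domain c) (EFin \o g) ->
  mu.-integrable (domain c) (EFin \o (fun t => f t + a * g t)) /\
  \int[mu]_(t in domain c) (f t + a * g t) =
    \int[mu]_(t in domain c) f t + a * \int[mu]_(t in domain c) g t.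
Proof.
have mD := measurable_domain c (R := R).
move=> intf intg.
have intag : mu.-integrable (domain c) (EFin \o (fun t => a * g t)).
  have := integrableZl mD a intg.
  by apply: eq_integrable => // t _; rewrite /= EFinM.
split; last by rewrite RintegralD// RintegralZl.
have := integrableD mD intf intag.
by apply: eq_integrable => // t _; rewrite /= EFinD.
Qed.

Lemma basis_fun_inverse_factor c M j x : admissible c -> (0 <= c -> 0 < M) -> domain c x ->
  basis_fun c M j x * inverse_factor c x =
  M%:~R / (M + j%:Z * c)%:~R *
    (if c == -1 then 0 else basis_fun c (M + c) j x).
Proof.
move=> hc M0 dx; rewrite /inverse_factor; case: eqP => [|/eqP c1]; first by rewrite !mulr0.
have c0 : 0 <= c by case: hc => //; lia.
have {}M0 := M0 c0.
have rx := domain_regular _ _ hc dx.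
have := basis_fun_shift c M j x c0 (ltW M0) rx.
have rx0 : 0 < 1 + c%:~R * x by move: rx; rewrite /regular (negPf c1).
have jc0 : 0 <= j%:Z * c by rewrite mulr_ge0.
have M1 : (M + j%:Z * c)%:~R != 0 :> R by rewrite intr_eq0; lia.
rewrite (_ : M%:~R + j%:R * c%:~R = (M + j%:Z * c)%:~R); last by rewrite rmorphD rmorphM.
move=> h; apply: (mulfI M1); rewrite mulrA -h.
move: (M1); rewrite rmorphD rmorphM /= => M2.
by field; rewrite (gt_eqF rx0) andbT; exact: M2.
Qed.

(** The pointwise bound is integrated against the nonnegative density. Multiplying the density by
    [t], by [t ^ 2] or by the inverse factor gives multiples of other basis functions, whose
    integrals are known, and this produces the closed forms. *)
Lemma durrmeyer_mean_dist c N k (f : R -> R) (a x A B D : R) :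
  admissible c -> 1 < N -> 2 * c < N -> (0 < k)%N -> (c = -1 -> k%:Z < N) ->
  continuous_bounded (domain c) f ->
  (forall t, domain c t ->
    `|f t - a| <= A + B * (t - x) ^+ 2 + D * inverse_factor c t) ->
  `|durrmeyer_mean c N k f - a| <=
    A + B * second_moment c N k x + D * inverse_moment c N k.
Proof.
move=> hc N1 cN; case: k => // j _ kN cbf fa.
have mD := measurable_domain c (R := R).
have hN1 : 0 < N + c by case: hc; lia.
have hN2 : 0 < N - c by case: hc; lia.
have N2 : N + 2 * c = N + c + c by lia.
have c1N : (N + c)%:~R != 0 :> R by rewrite intr_eq0; lia.
have NN : N%:~R != 0 :> R by rewrite intr_eq0; lia.
have cN1 : (N - c)%:~R != 0 :> R by rewrite intr_eq0; lia.
have cne : c <> -1 -> [/\ N + c + j.+1%:Z * c = N + 2 * c + j%:Z * c,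
    (N + 2 * c + j%:Z * c)%:~R != 0 :> R & (N + 2 * c)%:~R != 0 :> R].
  move=> c1; have c0 : 0 <= c by case: hc; lia.
  have jc : 0 <= j%:Z * c by rewrite mulr_ge0.
  by split; rewrite ?intr_eq0; lia.
have [N0 Nc0] : 0 <= N /\ 0 <= N + 2 * c by case: hc; lia.
have N2c : 0 <= c -> 0 < N + 2 * c by lia.
have int2 : mu.-integrable (domain c) (EFin \o basis_fun c (N + 2 * c) j).
  by rewrite N2; apply: integrable_basis_fun => //; lia.
have E2 : \int[mu]_(t in domain c) basis_fun c (N + 2 * c) j t = (N + c)%:~R^-1.
  by rewrite N2; apply: Rintegral_basis_fun => //; lia.
have int1 : mu.-integrable (domain c) (EFin \o basis_fun c (N + c) j.+1).
  by apply: integrable_basis_fun => //; lia.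
have E1 : \int[mu]_(t in domain c) basis_fun c (N + c) j.+1 t = N%:~R^-1.
  by apply: Rintegral_basis_fun => //; lia.
(* Writing [N] as [(N - c) + c], integrability at infinity asks for [c < N - c]; this is where
   [2 c < N] enters. *)
have int0 : mu.-integrable (domain c) (EFin \o basis_fun c N j.+2).
  rewrite -[X in basis_fun c X](subrK c); apply: integrable_basis_fun => //; lia.
have E0 : \int[mu]_(t in domain c) basis_fun c N j.+2 t = (N - c)%:~R^-1.
  rewrite -[X in basis_fun c X](subrK c); apply: Rintegral_basis_fun => //; lia.
pose q t : R := if c == -1 then 0 else basis_fun c (N + 2 * c + c) j t.
pose e : R := if c == -1 then 0 else (N + 2 * c)%:~R^-1.
have [int3 E3] : mu.-integrable (domain c) (EFin \o q) /\
    \int[mu]_(t in domain c) q t = e.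
  rewrite /q /e; case: eqP => [_|c1].
    split; last by rewrite Rintegral_cst ?mul0r.
    by apply: eq_integrable (integrable0 _ _).
  have c0 : 0 <= c by case: hc; lia.
  by split; [apply: integrable_basis_fun|apply: Rintegral_basis_fun] => //; lia.
have intf : mu.-integrable (domain c)
    (EFin \o (fun t => basis_fun c (N + 2 * c) j t * f t)).
  by rewrite N2; apply: integrable_basis_mul => //; lia.
pose w t : R := basis_fun c (N + 2 * c) j t.
have [intd Ed] := integrable_lin _ _ _ (- a) intf int2.
(* [e0], [e1], [e2], [e3] are the coefficients of the integrated upper bound in the functions with
   parameters [N + 2 c], [N + c], [N] and in [q]. The combination is built up from zero, one term at
   a time. *)
pose e0 := A + B * x ^+ 2.
pose e1 := - (2 * B * x * (j.+1%:R / (N + c)%:~R)).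
pose e2 := B * (j.+1%:R / (N + c)%:~R * (j.+2%:R / N%:~R)).
pose e3 := D * ((N + 2 * c)%:~R / (N + 2 * c + j%:Z * c)%:~R).
pose z (_ : R) : R := 0.
have intz : mu.-integrable (domain c) (EFin \o z) by exact: integrable0.
have Ez : \int[mu]_(t in domain c) z t = 0 by rewrite Rintegral_cst// mul0r.
have [ig0 Eg0] := integrable_lin _ _ _ e0 intz int2.
have [ig1 Eg1] := integrable_lin _ _ _ e1 ig0 int1.
have [ig2 Eg2] := integrable_lin _ _ _ e2 ig1 int0.
have [ig3 Eg3] := integrable_lin _ _ _ e3 ig2 int3.
have -> : durrmeyer_mean c N j.+1 f - a = (N + c)%:~R *
    \int[mu]_(t in domain c) (w t * f t + - a * w t).
  by rewrite Ed E2 /durrmeyer_mean /= mulrDr mulrCA divff// mulr1.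
rewrite normrM gtr0_norm ?ltr0z//.
have -> : A + B * second_moment c N j.+1 x + D * inverse_moment c N j.+1 =
    (N + c)%:~R * (0 + e0 * (N + c)%:~R^-1 + e1 * N%:~R^-1 + e2 * (N - c)%:~R^-1 +
    e3 * e).
  rewrite /e0 /e1 /e2 /e3 /e /second_moment /inverse_moment; case: eqP => c1.
    rewrite !mulr0 !addr0; move: ((N + c)%:~R) (N%:~R) ((N - c)%:~R) c1N NN cN1.
    by move=> n1 n2 n3 d1 d2 d3; field; rewrite d1 d2 d3.
  have [-> d1 d2] := cne c1.
  move: ((N + 2 * c + _)%:~R) ((N + 2 * c)%:~R) d1 d2 c1N NN cN1 => u v.
  move: ((N + c)%:~R) (N%:~R) ((N - c)%:~R) => n1 n2 n3 d1 d2 d3 d4 d5.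
  by field; rewrite d1 d2 d3 d4 d5.
rewrite -E2 -E1 -E0 -E3 -Ez -Eg0 -Eg1 -Eg2 -Eg3.
rewrite ler_pM2l ?ltr0z//.
apply: le_trans (le_normr_Rintegral mD intd) _.
apply: le_Rintegral => //; first exact: integrable_norm.
move=> t dt.
have wt0 : 0 <= w t by exact: basis_fun_ge0.
apply: (@le_trans _ _ (w t * `|f t - a|)).
  by rewrite -[w t in leRHS](ger0_norm wt0) -normrM mulrBr mulNr [a * _]mulrC.
apply: le_trans (ler_wpM2l wt0 (fa t dt)) _.
have rt := domain_regular _ _ hc dt.
have h1 : t * w t = j.+1%:R / (N + c)%:~R * basis_fun c (N + c) j.+1 t.
  have := basis_funS c (N + c) j t hc (ltW hN1) rt; rewrite -N2 => e'.
  by rewrite [RHS]mulrAC e' -[_ * t * _]mulrA [RHS]mulrC mulKf.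
have h2 : t * basis_fun c (N + c) j.+1 t = j.+2%:R / N%:~R * basis_fun c N j.+2 t.
  have e' := basis_funS c N j.+1 t hc N0 rt.
  by rewrite [RHS]mulrAC e' -[_ * t * _]mulrA [RHS]mulrC mulKf.
have h3 : w t * inverse_factor c t = (N + 2 * c)%:~R / (N + 2 * c + j%:Z * c)%:~R * q t.
  exact: basis_fun_inverse_factor.
rewrite le_eqVlt; apply/orP; left; apply/eqP.
transitivity (e0 * w t - 2 * B * x * (t * w t) + B * (t * (t * w t)) +
   D * (w t * inverse_factor c t)); first by rewrite /e0; ring.
rewrite h3 h1 [t * (_ * _)]mulrCA h2 /e1 /e2 /e3 /z -/(w t); ring.
Qed.

End durrmeyer_mean.

(** * Moment sums and Bezier weights *)

Section moments.
Context {R : realType}.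
Implicit Types (c M N : int) (x y : R).

Lemma sum_basis_first_moment c N K x : admissible c -> 0 <= N -> regular c x ->
  \sum_(k < K.+1) k%:R * basis_fun c N k x = N%:~R * x * mass c (N + c) K x.
Proof.
move=> hc N0 rx; rewrite big_ord_recl mul0r add0r /mass mulr_sumr.
by apply: eq_bigr => i _; rewrite -basis_funS.
Qed.

Lemma sum_basis_factorial_moment c N K x : admissible c -> 0 <= N -> 0 <= N + c ->
  regular c x ->
  \sum_(k < K.+2) k%:R * k.-1%:R * basis_fun c N k x =
    N%:~R * (N + c)%:~R * x ^+ 2 * mass c (N + c + c) K x.
Proof.
move=> hc N0 Nc rx; rewrite big_ord_recl !mul0r add0r.
transitivity (N%:~R * x * \sum_(k < K.+1) k%:R * basis_fun c (N + c) k x).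
  rewrite mulr_sumr; apply: eq_bigr => i _ /=.
  by rewrite mulrAC basis_funS// /bump /=; ring.
by rewrite sum_basis_first_moment//; ring.
Qed.

(** The closed form is a squared bias [(x - k / N) ^ 2] plus a variance with the sign of
    [k (N + c k)]. That can be negative only for [c = -1] and [k > N], where the basis function
    vanishes. *)
Lemma basis_second_moment_ge0 c N k x : admissible c -> 0 < N -> 0 < N - c ->
  domain c x -> 0 <= basis_fun c N k x * second_moment c N k x.
Proof.
move=> hc N0 Nc dx.
have n0 : 0 < N%:~R :> R by rewrite ltr0z.
have nc0 : 0 < (N - c)%:~R :> R by rewrite ltr0z.
have [kN|kN] := pselect (c = -1 /\ N < k%:Z).
  by case: kN => c1 kN; rewrite (basis_fun_gt c N k x)// ?mul0r// ltW.
apply: mulr_ge0; first by rewrite basis_fun_ge0// ltW.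
have e : second_moment c N k x = (x - k%:R / N%:~R) ^+ 2 +
    k%:R * (N + c * k%:Z)%:~R / (N%:~R ^+ 2 * (N - c)%:~R).
  rewrite /second_moment -natr1.
  have -> : (N + c * k%:Z)%:~R = N%:~R + (N%:~R - (N - c)%:~R) * k%:R :> R.
    by rewrite rmorphD rmorphM /= -[c in LHS](subKr N) rmorphB.
  move: (N%:~R) ((N - c)%:~R) n0 nc0 => n nc n0 nc0.
  by field; rewrite !gt_eqF.
rewrite e addr_ge0 ?sqr_ge0// divr_ge0//; last first.
  by rewrite mulr_ge0 ?exprn_ge0// ltW.
rewrite mulr_ge0// ler0z; case: hc => [c1|c0]; last by rewrite addr_ge0 ?mulr_ge0// ltW.
by rewrite c1 mulN1r subr_ge0 leNgt; apply/negP => h; apply: kN.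
Qed.

(** The partial sums are nondecreasing, hence bounded by their limit. The limit is read off from an
    expression in which all masses tend to [1]. *)
Lemma sum_basis_second_moment_le c N K x : admissible c -> 1 < N -> 0 < N - c ->
  domain c x ->
  \sum_(k < K) basis_fun c N k x * second_moment c N k x <=
    2 * (x * (1 + c%:~R * x)) / (N - c)%:~R.
Proof.
move=> hc N1 Nc dx; have N0 : 0 < N by lia.
have rx := domain_regular _ _ hc dx.
have Nc1 : 0 <= N + c by case: hc; lia.
have Nc2 : 0 <= N + c + c by case: hc; lia.
have n0 : 0 < N%:~R :> R by rewrite ltr0z.
have nc0 : 0 < (N - c)%:~R :> R by rewrite ltr0z.
pose V K := \sum_(k < K) basis_fun c N k x * second_moment c N k x.
have ndV : nondecreasing_seq V.
  apply/nondecreasing_seqP => k; rewrite /V big_ord_recr /= lerDl.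
  exact: basis_second_moment_ge0.
have VE k : V k.+2 = x ^+ 2 * mass c N k.+2 x +
    - 2 * x ^+ 2 * mass c (N + c) k.+1 x +
    ((N + c)%:~R / (N - c)%:~R * x ^+ 2 * mass c (N + c + c) k x +
     2 * x / (N - c)%:~R * mass c (N + c) k.+1 x).
  have := sum_basis_first_moment c N k.+1 x hc (ltW N0) rx.
  have := sum_basis_factorial_moment c N k x hc (ltW N0) Nc1 rx.
  set F2 := \sum_(_ < _) _ => F2E; set F1 := \sum_(_ < _) _ => F1E.
  (* The splitting [k (k + 1) = k (k - 1) + 2 k] reduces everything to the factorial and first
     moments. *)
  have -> : V k.+2 = x ^+ 2 * mass c N k.+2 x +
     (2 / (N%:~R * (N - c)%:~R) - 2 * x / N%:~R) * F1 +
     (N%:~R * (N - c)%:~R)^-1 * F2.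
    rewrite /V /F1 /F2 /mass !mulr_sumr -!big_split; apply: eq_bigr => -[[|i] ?] _ /=.
      by rewrite /second_moment; ring.
    rewrite /second_moment /= -[in i.+2%:R]natr1; ring.
  rewrite F1E F2E; move: (N%:~R) ((N - c)%:~R) ((N + c)%:~R) n0 nc0 => n nc n1 n0 nc0.
  by field; rewrite !gt_eqF.
have cV : V k @[k --> \oo] --> x ^+ 2 * 1 + - 2 * x ^+ 2 * 1 +
    ((N + c)%:~R / (N - c)%:~R * x ^+ 2 * 1 + 2 * x / (N - c)%:~R * 1).
  have cMl (a : R) (u : nat -> R) :
      u @ \oo --> (1 : R) -> (fun k => a * u k) @ \oo --> a * 1.
    by move=> h; apply: cvgM; [exact: cvg_cst|exact: h].
  have m0 : (fun k => mass c N k.+2 x) @ \oo --> (1 : R).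
    rewrite (cvg_shiftS (fun k => mass c N k.+1 x)) (cvg_shiftS (fun k => mass c N k x)).
    by apply: mass_cvg => //; exact: ltW.
  have m1 : (fun k => mass c (N + c) k.+1 x) @ \oo --> (1 : R).
    rewrite (cvg_shiftS (fun k => mass c (N + c) k x)).
    exact: mass_cvg.
  have m2 := mass_cvg c (N + c + c) x hc Nc2 dx.
  rewrite -cvg_shiftS -cvg_shiftS /=.
  under eq_fun do rewrite VE.
  exact: (cvgD (cvgD (cMl _ _ m0) (cMl _ _ m1)) (cvgD (cMl _ _ m2) (cMl _ _ m1))).
have : V K <= limn V.
  by apply: nondecreasing_cvgn_le => //; apply/cvg_ex; eexists; exact: cV.
rewrite (cvg_lim _ cV)// => /le_trans; apply.
rewrite le_eqVlt; apply/orP; left; apply/eqP.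
have -> : c%:~R = N%:~R - (N - c)%:~R :> R by rewrite -rmorphB; congr (_%:~R); lia.
have -> : (N + c)%:~R = 2 * N%:~R - (N - c)%:~R :> R.
  rewrite -[2]/(2%:~R) -rmorphM -rmorphB; congr (_%:~R); lia.
move: (N%:~R) ((N - c)%:~R) nc0 => n nc nc0.
by field; rewrite gt_eqF.
Qed.

(** [basis_fun_shift] trades the factor [1 + c x] for the parameter [N - c]. The remaining rational
    factor in [k] is at most [3] because [c <= N - c]. *)
Lemma basis_inverse_moment_le c N k x : admissible c -> 0 < N -> 2 * c < N ->
  domain c x ->
  basis_fun c N k x * ((1 + c%:~R * x) * inverse_moment c N k) <=
    3 * basis_fun c (N - c) k x.
Proof.
move=> hc N0 cN dx; have Nc0 : 0 < N - c by case: hc; lia.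
have rx := domain_regular _ _ hc dx.
rewrite /inverse_moment; case: eqP => c1.
  by rewrite !mulr0 mulr_ge0// basis_fun_ge0// ltW.
have c0 : 0 <= c by case: hc; lia.
have := basis_fun_shift c (N - c) k x c0 (ltW Nc0) rx; rewrite subrK => h.
have nc0 : 0 < (N - c)%:~R :> R by rewrite ltr0z.
have kc : 0 <= k%:R * c%:~R :> R by rewrite mulr_ge0// ler0z.
have cR : 0 <= c%:~R :> R by rewrite ler0z.
have -> : (N + c)%:~R = (N - c)%:~R + 2 * c%:~R :> R.
  rewrite -[2]/(2%:~R) -rmorphM -rmorphD; congr (_%:~R); lia.
have -> : (N + c + k%:Z * c)%:~R = (N - c)%:~R + 2 * c%:~R + k%:R * c%:~R :> R.
  rewrite -[2]/(2%:~R) -[k%:R]/((k%:Z)%:~R) -!rmorphM -!rmorphD; congr (_%:~R); lia.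
have cN' : c%:~R <= (N - c)%:~R :> R by rewrite ler_int; lia.
move: ((N - c)%:~R) (c%:~R) (k%:R * c%:~R) h nc0 kc cR cN' => n C kC h nc0 kc cR cN'.
set p := basis_fun c (N - c) k x in h *.
have p0 : 0 <= p by rewrite basis_fun_ge0// ltW.
have d0 : 0 < n + 2 * C + kC by lra.
have -> : basis_fun c N k x * ((1 + C * x) * ((n + 2 * C) / (n + 2 * C + kC))) =
   (n + kC) * p * ((n + 2 * C) / (n * (n + 2 * C + kC))).
  by rewrite -h; field; rewrite !gt_eqF.
have h1 : C * kC <= n * kC by exact: ler_wpM2r.
have h2 : 0 <= n * C by rewrite mulr_ge0// ltW.
have h3 : 0 <= n * kC by rewrite mulr_ge0// ltW.
have h4 : 0 <= n * n by rewrite mulr_ge0// ltW.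
have h5 : (n + kC) * (n + 2 * C) <= 3 * (n * (n + 2 * C + kC)) by lra.
rewrite mulrA ler_pdivrMr; last exact: mulr_gt0.
by have := ler_wpM2l p0 h5; lra.
Qed.

Lemma sum_basis_inverse_moment_le c N K x : admissible c -> 0 < N -> 2 * c < N ->
  domain c x ->
  \sum_(k < K) basis_fun c N k x * ((1 + c%:~R * x) * inverse_moment c N k) <= 3.
Proof.
move=> hc N0 cN dx.
have Nc0 : 0 <= N - c by case: hc; lia.
apply: (@le_trans _ _ (\sum_(k < K) 3 * basis_fun c (N - c) k x)).
  by apply: ler_sum => i _; exact: basis_inverse_moment_le.
by rewrite -mulr_sumr -[leRHS]mulr1 ler_pM2l// mass_le1.
Qed.

(** With [s = b / a] this is Bernoulli's inequality [1 - s ^ alpha <= alpha (1 - s)] scaled by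
    [a ^ alpha <= a]. Bernoulli's inequality is Young's inequality for [s] and [1] with exponents
    [alpha] and [alpha / (alpha - 1)], whence the separate case [alpha = 1]. *)
Lemma powR_sub_le (alpha a b : R) : 1 <= alpha -> 0 <= b -> b <= a -> a <= 1 ->
  a `^ alpha - b `^ alpha <= alpha * (a - b).
Proof.
move=> al1 b0 ba a1; have al0 : 0 < alpha by rewrite (lt_le_trans _ al1).
have [->|aln1] := eqVneq alpha 1.
  by rewrite !powRr1 ?mul1r// (le_trans b0).
have [an0|an0] := eqVneq a 0.
  have -> : b = 0 by apply/eqP; rewrite eq_le b0 -an0 ba.
  by rewrite an0 !subrr mulr0.
have a0 : 0 < a by rewrite lt_neqAle eq_sym an0 (le_trans b0).
have s0 : 0 <= b / a by rewrite divr_ge0// ltW.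
have al1' : 0 < alpha - 1 by rewrite subr_gt0 lt_neqAle eq_sym aln1.
have := @conjugate_powR R (b / a) 1 alpha (alpha / (alpha - 1)) s0 ler01 al0.
have q0 : 0 < alpha / (alpha - 1) by rewrite divr_gt0.
move=> /(_ q0); rewrite powR1 mulr1.
have -> : alpha^-1 + (alpha / (alpha - 1))^-1 = 1.
  by field; rewrite !gt_eqF.
move=> /(_ erefl) bern.
have -> : b `^ alpha = a `^ alpha * (b / a) `^ alpha.
  by rewrite -powRM// ?(ltW a0)// mulrC divfK.
have aa : a `^ alpha <= a.
  by rewrite -[leRHS]powRr1 ?(ltW a0)// ger_powR// a0.
have -> : alpha * (a - b) = a * (alpha * (1 - b / a)) by field; rewrite gt_eqF.
have bern' : 1 - (b / a) `^ alpha <= alpha * (1 - b / a).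
  move: bern; rewrite -(ler_pM2l al0); move: (b / a) ((b / a) `^ alpha) => s sa.
  have -> : alpha * (sa / alpha + 1 / (alpha / (alpha - 1))) = sa + (alpha - 1).
    by field; rewrite !gt_eqF.
  lra.
rewrite -{1}[a `^ alpha]mulr1 -mulrBr.
apply: (@le_trans _ _ (a `^ alpha * (alpha * (1 - b / a)))).
  by rewrite ler_wpM2l// powR_ge0.
rewrite ler_wpM2r// mulr_ge0 ?(ltW al0)// subr_ge0 ler_pdivrMr ?mul1r//.
Qed.

Lemma bezierE c alpha N k x : admissible c -> 0 <= N -> domain c x ->
  bezier c alpha N k x =
    (1 - mass c N k x) `^ alpha - (1 - mass c N k.+1 x) `^ alpha.
Proof. by move=> hc N0 dx; rewrite /bezier !tailE. Qed.

Lemma bezier_ge0 c alpha N k x : admissible c -> 0 <= N -> domain c x ->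
  1 <= alpha -> 0 <= bezier c alpha N k x.
Proof.
move=> hc N0 dx al; rewrite bezierE// subr_ge0 ge0_ler_powR//.
- by rewrite (le_trans _ al).
- by rewrite nnegrE subr_ge0 mass_le1.
- by rewrite nnegrE subr_ge0 mass_le1.
- by rewrite lerD2l lerN2 massS lerDl basis_fun_ge0.
Qed.

Lemma bezier_le c alpha N k x : admissible c -> 0 <= N -> domain c x ->
  1 <= alpha -> bezier c alpha N k x <= alpha * basis_fun c N k x.
Proof.
move=> hc N0 dx al; rewrite bezierE//.
apply: le_trans (powR_sub_le alpha _ _ al _ _ _) _.
- by rewrite subr_ge0 mass_le1.
- by rewrite lerD2l lerN2 massS lerDl basis_fun_ge0.
- by rewrite gerBl mass_ge0.
- by rewrite massS le_eqVlt; apply/orP; left; apply/eqP; ring.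
Qed.

Lemma sum_bezier c alpha N K x : admissible c -> 0 <= N -> domain c x ->
  1 <= alpha ->
  \sum_(k < K) bezier c alpha N k x = 1 - (1 - mass c N K x) `^ alpha.
Proof.
move=> hc N0 dx al; elim: K => [|K ih].
  by rewrite big_ord0 mass0 subr0 powR1 subrr.
by rewrite big_ord_recr /= ih bezierE// addrA subrK.
Qed.

(** On [[0, 1]] the power [alpha] lies below the identity, so the telescoped sums lie between [mass]
    and [1]. *)
Lemma sum_bezier_cvg c alpha N x : admissible c -> 0 <= N -> domain c x ->
  1 <= alpha ->
  (fun K => \sum_(k < K) bezier c alpha N k x) @ \oo --> (1 : R).
Proof.
move=> hc N0 dx al.
apply: (@squeeze_cvgr _ _ _ _ (fun K => mass c N K x) (fun=> 1)).
- near=> K; rewrite sum_bezier// gerBl powR_ge0 andbT.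
  have u0 : 0 <= 1 - mass c N K x by rewrite subr_ge0 mass_le1.
  have u1 : 1 - mass c N K x <= 1 by rewrite gerBl mass_ge0.
  have : (1 - mass c N K x) `^ alpha <= 1 - mass c N K x; last by lra.
  have [->|un0] := eqVneq (1 - mass c N K x) 0.
    by rewrite powR0// gt_eqF// (lt_le_trans _ al).
  by rewrite -[leRHS]powRr1// ger_powR// u1 andbT lt_neqAle eq_sym un0.
- exact: mass_cvg.
- exact: cvg_cst.
Unshelve. all: by end_near. Qed.

End moments.

(** * Steps and walks controlled by the modulus of smoothness *)

Section modulus.
Context {R : realType}.
Implicit Types (c : int) (x y t u v : R).

Lemma weight_ge0 c x : 0 <= weight c x.
Proof. exact: sqrtr_ge0. Qed.

(** Boundedness of [f] makes [sup] a genuine supremum, so that single differences can be compared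
    with it. *)
Lemma ditzian_totik_ub c (beta : R) (f : R -> R) (delta : R) :
  continuous_bounded (domain c) f ->
  has_ubound [set w | exists h y : R,
    let s := h * weight c y `^ beta / 2 in
    [/\ 0 <= h <= delta, domain c (y + s), domain c (y - s) &
        w = `|f (y + s) - f (y - s)|]].
Proof.
move=> [_ [B [_ hB]]]; exists ((B + 1) + (B + 1)) => w [h [y /= [_ d1 d2 ->]]].
have B1 : B < B + 1 by rewrite ltrDl.
apply: le_trans (ler_normB _ _) _.
by apply: lerD; exact: hB.
Qed.

Lemma ditzian_totik_ge0 c (beta : R) (f : R -> R) (delta : R) :
  continuous_bounded (domain c) f -> 0 <= delta ->
  0 <= ditzian_totik c beta f delta.
Proof.
move=> cbf d0; apply: ub_le_sup; first exact: ditzian_totik_ub.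
exists 0, 0 => /=; rewrite !mul0r addr0 subr0 subrr normr0 lexx d0.
by split=> //; exact: domain0.
Qed.

Lemma ditzian_totik_step c (beta : R) (f : R -> R) (delta u v : R) :
  continuous_bounded (domain c) f -> 0 <= delta ->
  domain c u -> domain c v -> u <= v ->
  v - u <= delta * weight c ((u + v) / 2) `^ beta ->
  `|f u - f v| <= ditzian_totik c beta f delta.
Proof.
move=> cbf d0 du dv uv huv; have [->|unv] := eqVneq u v.
  by rewrite subrr normr0 ditzian_totik_ge0.
have uv0 : 0 < v - u by rewrite subr_gt0 lt_neqAle unv.
set w := weight c _ `^ _ in huv.
have w0 : 0 < w.
  rewrite lt_neqAle powR_ge0 andbT eq_sym; apply/eqP => w0.
  by move: huv; rewrite w0 mulr0 leNgt uv0.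
apply: ub_le_sup; first exact: ditzian_totik_ub.
(* The midpoint serves as [y], and [h] is chosen so that [y - s] and [y + s] are [u] and [v]. *)
exists ((v - u) / w), ((u + v) / 2) => /=; rewrite -/w divfK ?gt_eqF//.
have -> : (u + v) / 2 + (v - u) / 2 = v by lra.
have -> : (u + v) / 2 - (v - u) / 2 = u by lra.
split=> //; last by rewrite distrC.
by rewrite ler_pdivrMr// huv andbT divr_ge0// ltW.
Qed.

(* [r = r `^ (1 - beta) * r `^ beta], so the two weights need only be compared
   with [r], and [beta] plays no further role. *)
Lemma modulus_step c (beta x sn r u v : R) (f : R -> R) :
  0 <= beta <= 1 -> continuous_bounded (domain c) f -> 0 < sn ->
  domain c u -> domain c v -> u <= v -> 0 <= r -> r <= weight c x ->
  r <= weight c ((u + v) / 2) -> v - u <= r / sn ->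
  `|f u - f v| <= ditzian_totik c beta f (weight c x `^ (1 - beta) / sn).
Proof.
move=> /andP[b0 b1] cbf sn0 du dv uv r0 rx rm uvr.
apply: ditzian_totik_step => //; first by rewrite divr_ge0 ?powR_ge0// ltW.
apply: le_trans uvr _; rewrite mulrAC ler_pM2r ?invr_gt0//.
have {1}-> : r = r `^ (1 - beta) * r `^ beta.
  rewrite -powRD; first by rewrite subrK powRr1.
  by rewrite subrK oner_eq0.
apply: ler_pM; rewrite ?powR_ge0//; apply: ge0_ler_powR => //;
  by rewrite ?subr_ge0// nnegrE// ?weight_ge0.
Qed.

(** The triangle inequality over equal steps. Their number is one more than the integer part of
    [(b - a) / e]: enough for each step to have length at most [e], and at most
    [1 + (b - a) / e]. *)
Lemma le_dist_steps (g : R -> R) (w e a b : R) : 0 < e -> a <= b ->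
  (forall s s', a <= s -> s <= s' -> s' <= b -> s' - s <= e ->
    `|g s - g s'| <= w) ->
  `|g a - g b| <= w * (1 + (b - a) / e).
Proof.
move=> e0 ab step.
have w0 : 0 <= w.
  have := step a a (lexx a) (lexx a) ab; rewrite !subrr normr0; apply; exact: ltW.
have q0 : 0 <= (b - a) / e by rewrite divr_ge0 ?subr_ge0// ltW.
have /andP[q1 q2] := truncn_itv q0.
set K := (Num.truncn ((b - a) / e)).+1 in q2.
have K0 : 0 < K%:R :> R by rewrite ltr0n.
pose d := (b - a) / K%:R.
have d0 : 0 <= d by rewrite divr_ge0 ?subr_ge0// ltW.
have de : d <= e.
  by rewrite ler_pdivrMr// mulrC -ler_pdivrMr// ltW.
have Kd : K%:R * d = b - a by rewrite mulrC divfK// gt_eqF.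
have walk i : (i <= K)%N -> `|g a - g (a + i%:R * d)| <= i%:R * w.
  elim: i => [|i ih] iK; first by rewrite mul0r addr0 subrr normr0 mul0r.
  rewrite -[g a](subrK (g (a + i%:R * d))) -addrA.
  apply: le_trans (ler_normD _ _) _.
  have -> : i.+1%:R * w = i%:R * w + w by rewrite -natr1 mulrDl mul1r.
  apply: lerD; first exact: ih (ltnW iK).
  apply: step.
  - by rewrite lerDl mulr_ge0.
  - by rewrite lerD2l ler_wpM2r// ler_nat.
  - by rewrite -lerBrDl -Kd ler_wpM2r// ler_nat.
  - by rewrite -natr1 (_ : _ - _ = d)//; ring.
have := walk K (leqnn K); rewrite Kd [a + _]addrC subrK => /le_trans; apply.
by rewrite mulrC ler_wpM2l// /K -nat1r lerD2l.
Qed.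

(* In the coordinate [sqrt u] all steps may be taken of the same length, since
   the weight at [y] is at least [sqrt (y * L)] between [t] and [x]. *)
Lemma dist_le_left (F : R -> R) c (w sn t x L : R) :
  0 < sn -> 0 <= t -> t <= x -> 0 < x -> 0 < L ->
  (forall y, t <= y -> y <= x -> L <= 1 + c%:~R * y) ->
  (forall u v r, t <= u -> u <= v -> v <= x -> 0 <= r -> r <= weight c x ->
     r <= weight c ((u + v) / 2) -> v - u <= r / sn -> `|F u - F v| <= w) ->
  `|F t - F x| <= w * (1 + sn ^+ 2 * (t - x) ^+ 2 / (x * (1 + c%:~R * x)) +
                       (1 + c%:~R * x) / L).
Proof.
move=> sn0 t0 tx x0 L0 hL step.
have w0 : 0 <= w.
  have := step t t 0 (lexx t) (lexx t) tx (lexx 0) (weight_ge0 c x) (weight_ge0 c _).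
  by rewrite mul0r !subrr normr0; apply; exact: lexx.
have sL0 : 0 < Num.sqrt L by rewrite sqrtr_gt0.
have sx0 : 0 < Num.sqrt x by rewrite sqrtr_gt0.
have st0 : 0 <= Num.sqrt t by exact: sqrtr_ge0.
have stx : Num.sqrt t <= Num.sqrt x by rewrite ler_sqrt// ltW.
have Ex : Num.sqrt x ^+ 2 = x by rewrite sqr_sqrtr// ltW.
have Et : Num.sqrt t ^+ 2 = t by rewrite sqr_sqrtr.
have EL : Num.sqrt L ^+ 2 = L by rewrite sqr_sqrtr// ltW.
(* This step length in the coordinate [sqrt u] suits the modulus:
   [s' ^ 2 - s ^ 2 = (s' - s) (s' + s)], and [(s' + s) / 2] is at most [sqrt m] for the midpoint [m]
   of the squares. *)
have e0 : 0 < Num.sqrt L / (2 * sn) by rewrite divr_gt0// mulr_gt0.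
have M0 : 0 < 1 + c%:~R * x by rewrite (lt_le_trans L0)// hL.
have := @le_dist_steps (fun s => F (s ^+ 2)) w _ _ _ e0 stx.
rewrite Ex Et => /(_ _)/le_trans; apply; last first.
  rewrite ler_wpM2l// -addrA lerD2l.
  set M := 1 + _ in M0 *; have sM0 : 0 < Num.sqrt M by rewrite sqrtr_gt0.
  have EM : Num.sqrt M ^+ 2 = M by rewrite sqr_sqrtr// ltW.
  (* The number of steps is at most [1 + 2 p q], and [2 p q <= p ^ 2 + q ^ 2] separates it into the
     two summands of the claim. *)
  pose p := sn * (x - t) / (Num.sqrt x * Num.sqrt M).
  pose q := Num.sqrt M / Num.sqrt L.
  have -> : sn ^+ 2 * (t - x) ^+ 2 / (x * M) + M / L = p ^+ 2 + q ^+ 2.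
    rewrite /p /q -{2}Ex -{1 2}EM -{1}EL; field.
    by rewrite !gt_eqF.
  apply: (@le_trans _ _ (2 * (p * q))); last first.
    by have := sqr_ge0 (p - q); nra.
  have -> : 2 * (p * q) = (x - t) / Num.sqrt x / (Num.sqrt L / (2 * sn)).
    by rewrite /p /q; field; rewrite !gt_eqF.
  rewrite ler_pM2r ?invr_gt0// ler_pdivlMr//.
  have : (Num.sqrt x - Num.sqrt t) * Num.sqrt x <= Num.sqrt x ^+ 2 - Num.sqrt t ^+ 2.
    by move: (Num.sqrt x) (Num.sqrt t) sx0 st0 stx => a b *; nra.
  by rewrite Ex Et.
move=> s s' s0 ss' s'x ss'e.
have s0' : 0 <= s by rewrite (le_trans st0).
have s'0 : 0 <= s' by rewrite (le_trans s0').
have hs : t <= s ^+ 2 by rewrite -Et ler_sqr// nnegrE.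
have hs' : s' ^+ 2 <= x by rewrite -Ex ler_sqr// nnegrE// ltW.
have hss : s ^+ 2 <= s' ^+ 2 by rewrite ler_sqr// nnegrE.
set m := (s ^+ 2 + s' ^+ 2) / 2.
have tm : t <= m by rewrite /m; lra.
have mx : m <= x by rewrite /m; lra.
have m0 : 0 <= m by rewrite (le_trans t0).
(* [sqrt (m L)] lies below both weights, since [m <= x] and [L] bounds [1 + c y] from below at [m]
   and at [x]. *)
apply: (step _ _ (Num.sqrt (m * L))) => //.
- rewrite /weight ler_sqrt; last by rewrite mulr_ge0// ltW.
  by apply: ler_pM => //; [exact: ltW|exact: hL].
- rewrite /weight -/m ler_sqrt; last by rewrite mulr_ge0// (le_trans (ltW L0))// hL.
  by apply: ler_pM => //; [exact: ltW|exact: hL].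
- rewrite sqrtrM// ler_pdivlMr//.
  have h : (s' + s) / 2 <= Num.sqrt m.
    rewrite -[leLHS]ger0_norm ?divr_ge0 ?addr_ge0// -sqrtr_sqr ler_sqrt//.
    rewrite /m; have := sqr_ge0 (s' - s); nra.
  move: ss'e; rewrite ler_pdivlMr ?mulr_gt0// => ss'e.
  have h1 : (s' - s) * (2 * sn) * ((s' + s) / 2) <= Num.sqrt L * Num.sqrt m.
    apply: ler_pM => //; rewrite ?divr_ge0 ?addr_ge0//.
    by rewrite !mulr_ge0 ?subr_ge0// ltW.
  rewrite [leRHS]mulrC; apply: le_trans h1; rewrite le_eqVlt; apply/orP; left.
  by apply/eqP; field.
Qed.

End modulus.

(** * Pointwise bound on [f] and its average over the Bezier weights *)

Section approximation.
Context {R : realType}.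
Implicit Types (c m N : int) (x y t : R).

Lemma weight_gt0 c x : admissible c -> domain c x -> 0 < weight c x ->
  0 < x /\ 0 < 1 + c%:~R * x.
Proof.
move=> hc dx; rewrite /weight sqrtr_gt0 => h.
have x0 := domain_ge0 _ _ dx; have M0 := domain_factor_ge0 _ _ hc dx.
by split; rewrite lt_neqAle ?x0 ?M0 andbT eq_sym; apply/eqP => e;
  move: h; rewrite e ?mul0r ?mulr0 ltxx.
Qed.

Lemma weight_eq0 c x : admissible c -> domain c x -> weight c x <= 0 ->
  x = 0 \/ c = -1 /\ x = 1.
Proof.
move=> hc dx; rewrite /weight => h.
have x0 := domain_ge0 _ _ dx; have M0 := domain_factor_ge0 _ _ hc dx.
have : Num.sqrt (x * (1 + c%:~R * x)) == 0 by rewrite eq_le h sqrtr_ge0.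
rewrite sqrtr_eq0 => h'.
have /eqP : x * (1 + c%:~R * x) == 0 by rewrite eq_le h' mulr_ge0.
move/eqP; rewrite mulf_eq0 => /orP[/eqP->|/eqP e]; first by left.
have rx := domain_regular _ _ hc dx; move: rx; rewrite /regular e ltxx orbF => /eqP c1.
by right; split=> //; move: e; rewrite c1 /= => e; lra.
Qed.

Lemma inverse_factor_ge0 c t : admissible c -> domain c t -> 0 <= inverse_factor c t.
Proof.
move=> hc dt; rewrite /inverse_factor; case: ifP => // _.
by rewrite invr_ge0; exact: domain_factor_ge0.
Qed.

Lemma modulus_bound c (beta sn x t : R) (f : R -> R) : admissible c ->
  0 <= beta <= 1 -> continuous_bounded (domain c) f -> 0 < sn ->
  domain c x -> 0 < weight c x -> domain c t ->
  `|f t - f x| <= ditzian_totik c beta f (weight c x `^ (1 - beta) / sn) *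
    (2 + 2 * (sn ^+ 2 * (t - x) ^+ 2 / (x * (1 + c%:~R * x))) +
     (1 + c%:~R * x) * inverse_factor c t).
Proof.
move=> hc hb cbf sn0 dx wx dt.
have cn : 0 <= c -> (c == -1) = false by lia.
have [x0 M0] := weight_gt0 c x hc dx wx.
set w := ditzian_totik _ _ _ _.
have w0 : 0 <= w by apply: ditzian_totik_ge0 => //; rewrite divr_ge0 ?powR_ge0// ltW.
have step u v r : domain c u -> domain c v -> u <= v -> 0 <= r ->
    r <= weight c x -> r <= weight c ((u + v) / 2) -> v - u <= r / sn ->
    `|f u - f v| <= w.
  exact: modulus_step.
have t0 := domain_ge0 _ _ dt.
set A := sn ^+ 2 * _ / _.
have A0 : 0 <= A by rewrite divr_ge0// mulr_ge0 ?sqr_ge0 ?ltW.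
have I0 : 0 <= (1 + c%:~R * x) * inverse_factor c t.
  by rewrite mulr_ge0 ?inverse_factor_ge0// ltW.
have [tx|xt] := leP t x.
  case: (hc) => [c1|c0].
  (* For [c = -1] the factor [1 + c y] decreases, so its minimum is at [x]; the quotient by [L]
     becomes [1]. *)
  - apply: (le_trans (dist_le_left f c w sn t x (1 + c%:~R * x) sn0 t0 tx x0 M0 _ _)).
    + by move=> y _ yx; rewrite c1 /=; lra.
    + move=> u v r tu uv vx; apply: step => //; apply: domain_ball dx _ _ => //.
      * exact: le_trans tu. * exact: le_trans vx.
      * by rewrite (le_trans t0)// (le_trans tu).
    + by rewrite divff ?gt_eqF// ler_wpM2l// -/A; lra.
  - have ct0 : 0 <= c%:~R * t by rewrite mulr_ge0// ler0z.
    have L0 : 0 < 1 + c%:~R * t by rewrite ltr_pwDl.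
    (* For [0 <= c] the minimum of [1 + c y] is at [t], which is what brings in the inverse
       factor. *)
    apply: (le_trans (dist_le_left f c w sn t x (1 + c%:~R * t) sn0 t0 tx x0 L0 _ _)).
    + by move=> y ty _; rewrite lerD2l ler_wpM2l// ler0z.
    + move=> u v r tu uv vx; apply: step => //; apply: domain_ball dx _ _ => //.
      * exact: le_trans tu. * exact: le_trans vx.
      * by rewrite (le_trans t0)// (le_trans tu).
    + rewrite ler_wpM2l// -/A /inverse_factor.
      by rewrite cn//; lra.
rewrite distrC; case: (hc) => [c1|c0].
- have x1 : x < 1 by move: M0; rewrite c1 /=; lra.
  have t1 : t <= 1 by exact: domain_ge1 dt c1.
  have wsym y : weight c (1 - y) = weight c y.
    by rewrite /weight c1 /=; congr Num.sqrt; ring.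
  have xt' : 1 - t <= 1 - x by lra.
  (* The reflection [y -> 1 - y] preserves the Bernstein weight and exchanges the two sides of
     [x]. *)
  have := dist_le_left (fun y => f (1 - y)) c w sn (1 - t) (1 - x) x sn0 _ xt' _ x0 _ _.
  rewrite !subKr distrC => /(_ _ _ _ _)/le_trans; apply; rewrite ?subr_ge0 ?subr_gt0//.
  + by move=> y _ yx; rewrite c1 /=; lra.
  + move=> u v r tu uv vx r0; rewrite wsym => rx rm uvr; rewrite distrC.
    apply: (step _ _ r) => //.
    * by apply: domain_ball dt _ _; lra.
    * by apply: domain_ball dt _ _; lra.
    * by lra.
    * by rewrite (_ : (_ + _) / 2 = 1 - (u + v) / 2) ?wsym//; field.
    * by rewrite (_ : _ - _ = v - u)//; ring.
  + have -> : 1 + c%:~R * (1 - x) = x by rewrite c1 /=; ring.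
    rewrite divff ?gt_eqF// ler_wpM2l//.
    have -> : sn ^+ 2 * (1 - t - (1 - x)) ^+ 2 / ((1 - x) * x) = A.
      rewrite /A c1 /= (_ : 1 - t - (1 - x) = - (t - x)); last by ring.
      by rewrite sqrrN mulN1r [x * _]mulrC.
    lra.
(* To the right of [x] with [0 <= c] the weight increases, so steps of the constant length
   [weight c x / sn] are allowed. *)
- have e0 : 0 < weight c x / sn by rewrite divr_gt0.
  apply: (le_trans (le_dist_steps f w _ x t e0 (ltW xt) _)).
    move=> s s' xs ss' s't ss'e; apply: (step _ _ (weight c x)) => //.
    + exact: domain_ball dt (le_trans (ltW x0) xs) (le_trans ss' s't).
    + exact: domain_ball dt (le_trans (ltW x0) (le_trans xs ss')) s't.
    + exact: weight_ge0.
    + rewrite /weight ler_sqrt; last first.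
        rewrite mulr_ge0//; first by lra.
        rewrite addr_ge0// mulr_ge0 ?ler0z//; lra.
      apply: ler_pM; rewrite ?(ltW x0) ?(ltW M0)//; first by lra.
      by rewrite lerD2l ler_wpM2l ?ler0z//; lra.
  rewrite ler_wpM2l//.
  have -> : (t - x) / (weight c x / sn) = sn * (t - x) / weight c x.
    by field; rewrite !gt_eqF.
  have EA : A = (sn * (t - x) / weight c x) ^+ 2.
    rewrite /A !exprMn exprVn /weight sqr_sqrtr// ltW// mulr_gt0//.
  (* The linear step count [p] satisfies [2 p <= 1 + p ^ 2], so [1 + p] fits into [2 + 2 p ^ 2]. *)
  rewrite EA; have := sqr_ge0 (sn * (t - x) / weight c x - 1); nra.
Qed.

(* In the Bernstein case [c = -1] the last mean, like the one at [k = 0], is the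
   value at an end point. *)
Definition mean_value c N (f : R -> R) k : R :=
  if k == 0%N then f 0 else
  if (c == -1) && (k%:Z == N) then f 1 else durrmeyer_mean c N k f.

(** The closed forms remain exact at the end points: at [k = 0] the second moment is [(0 - x) ^ 2]
    and the inverse moment is [1] for [0 <= c]; for [c = -1] and [k = N] the second moment is
    [(1 - x) ^ 2]. *)
Lemma mean_value_dist c N k (f : R -> R) (a x A B D : R) :
  admissible c -> 1 < N -> 2 * c < N -> (c = -1 -> k%:Z <= N) ->
  continuous_bounded (domain c) f ->
  (forall t, domain c t ->
    `|f t - a| <= A + B * (t - x) ^+ 2 + D * inverse_factor c t) ->
  `|mean_value c N f k - a| <=
    A + B * second_moment c N k x + D * inverse_moment c N k.
Proof.
move=> hc N1 cN kN cbf fa; rewrite /mean_value; case: eqP => [->|k0].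
  have -> : second_moment c N 0 x = (0 - x) ^+ 2.
    by rewrite /second_moment !mul0r mulr0 subrr add0r sub0r sqrrN.
  have -> : inverse_moment c N 0 = inverse_factor c (0 : R).
    rewrite /inverse_moment /inverse_factor mul0r mulr0 !addr0 invr1.
    case: eqP => // c1; rewrite divff// intr_eq0; case: hc; lia.
  exact: fa (domain0 c).
case: ifP => [/andP[/eqP c1 /eqP kE]|ck].
  have d1 : domain c (1 : R) by rewrite /domain c1 /= in_itv /= ler01 lexx.
  have := fa 1 d1; rewrite /second_moment /inverse_factor /inverse_moment c1 /=.
  have n0 : N%:~R != 0 :> R by rewrite intr_eq0; lia.
  have -> : k%:R = N%:~R :> R by rewrite -kE.
  have -> : k.+1%:R = (N - -1)%:~R :> R by rewrite (_ : N - -1 = k.+1%:Z)//; lia.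
  have n1 : (N - -1)%:~R != 0 :> R by rewrite intr_eq0; lia.
  by rewrite divff ?mulf_neq0// divff// mulr1 (_ : (1 - x) ^+ 2 = 1 - 2 * x + x ^+ 2); [|ring].
apply: durrmeyer_mean_dist => //; first by rewrite lt0n; apply/eqP.
by move=> c1; move: ck (kN c1); rewrite c1 eqxx /=; lia.
Qed.

(** The constant is [13 = 2 + 8 + 3]: [2] from the constant term and [mass <= 1], [8] from the
    second moment together with [sn ^ 2 <= 2 (N - c)], and [3] from the inverse moment. *)
Lemma sum_bezier_dist c alpha (beta sn x : R) N K (f : R -> R) :
  admissible c -> 1 <= alpha -> 0 <= beta <= 1 -> 1 < N -> 2 * c < N ->
  0 < sn -> sn ^+ 2 <= 2 * (N - c)%:~R -> (c = -1 -> K%:Z <= N + 1) ->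
  continuous_bounded (domain c) f -> domain c x ->
  \sum_(k < K) bezier c alpha N k x * `|mean_value c N f k - f x| <=
    13 * alpha * ditzian_totik c beta f (weight c x `^ (1 - beta) / sn).
Proof.
move=> hc al hb N1 cN sn0 snN KN cbf dx; have N0 : 0 <= N by clear - N1; lia.
have Nc0 : 0 < N - c by clear - hc N1 cN; case: hc; lia.
have kN (k : 'I_K) : c = -1 -> k%:Z <= N.
  by clear - KN => /KN; have := ltn_ord k; lia.
have al0 : 0 <= alpha by rewrite (le_trans _ al).
set w := ditzian_totik _ _ _ _.
have w0 : 0 <= w by apply: ditzian_totik_ge0 => //; rewrite divr_ge0 ?powR_ge0// ltW.
have bez k : basis_fun c N k x = 0 -> bezier c alpha N k x = 0.
  move=> p0; apply/eqP; rewrite eq_le bezier_ge0// andbT.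
  by have := bezier_le c alpha N k x hc N0 dx al; rewrite p0 mulr0.
have [wx|wx] := ltP 0 (weight c x); last first.
  (* Where the weight vanishes, [x] is an end point. The one basis function that survives there goes
     with the value of [f] at [x] itself, so every summand is zero. *)
  rewrite big1; first by rewrite !mulr_ge0.
  move=> [k kK] _ /=; case: (weight_eq0 c x hc dx wx) => [xE|[c1 xE]].
    case: k kK => [|k] kK; first by rewrite xE /mean_value eqxx subrr normr0 mulr0.
    by rewrite bez ?mul0r// xE basis_fun_at0.
  have {}kN : k%:Z <= N by exact: kN (Ordinal kK) c1.
  have [kE|kE] := eqVneq k%:Z N.
    rewrite /mean_value kE c1 !eqxx /= xE (_ : (k == 0%N) = false); last by lia.
    by rewrite subrr normr0 mulr0.
  by rewrite bez ?mul0r// c1 xE basis_fun_at1// lt_neqAle kE.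
have [x0 M0] := weight_gt0 c x hc dx wx.
pose P := x * (1 + c%:~R * x).
have P0 : 0 < P by exact: mulr_gt0.
have nc0 : 0 < (N - c)%:~R :> R by rewrite ltr0z.
pose B := w * (2 * (sn ^+ 2 / P)).
have B0 : 0 <= B by rewrite !mulr_ge0 ?invr_ge0 ?sqr_ge0// ltW.
pose Z k := w * 2 + B * second_moment c N k x +
  (w * (1 + c%:~R * x)) * inverse_moment c N k.
have TZ (k : 'I_K) : `|mean_value c N f k - f x| <= Z k.
  apply: mean_value_dist => //; first exact: kN.
  move=> t dt; have := modulus_bound c beta sn x t f hc hb cbf sn0 dx wx dt.
  move=> /le_trans; apply; rewrite -/w le_eqVlt; apply/orP; left; apply/eqP.
  by rewrite /B /P; ring.
apply: (@le_trans _ _ (\sum_(k < K) alpha * (basis_fun c N k x * Z k))).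
  apply: ler_sum => k _; rewrite mulrA; apply: ler_pM => //; first exact: bezier_ge0.
  exact: bezier_le.
have m1 := mass_le1 c N K x hc N0 dx.
have m2 := sum_basis_second_moment_le c N K x hc N1 Nc0 dx.
have m3 := sum_basis_inverse_moment_le c N K x hc (lt_trans ltr01 N1) cN dx.
have -> : \sum_(k < K) alpha * (basis_fun c N k x * Z k) =
  alpha * (w * 2 * mass c N K x +
    B * (\sum_(k < K) basis_fun c N k x * second_moment c N k x) +
    w * (\sum_(k < K) basis_fun c N k x * ((1 + c%:~R * x) * inverse_moment c N k))).
  rewrite /mass !mulr_sumr -!big_split mulr_sumr; apply: eq_bigr => k _ /=.
  by rewrite /Z; ring.
have -> : 13 * alpha * w = alpha * (w * 13) by ring.
rewrite ler_wpM2l//.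
have h1 : w * 2 * mass c N K x <= w * 2.
  by rewrite ler_piMr// mulr_ge0.
have h3 := ler_wpM2l w0 m3.
have h2 : B * (\sum_(k < K) basis_fun c N k x * second_moment c N k x) <= w * 8.
  apply: le_trans (ler_wpM2l B0 m2) _.
  have -> : B * (2 * (x * (1 + c%:~R * x)) / (N - c)%:~R) =
      w * (4 * (sn ^+ 2 / (N - c)%:~R)).
    rewrite /B -/P; move: ((N - c)%:~R) nc0 => nc nc0; field.
    by rewrite !gt_eqF.
  rewrite ler_wpM2l// -[8]/((4 * 2)%N%:R) natrM ler_wpM2l//.
  by rewrite ler_pdivrMr.
by lra.
Qed.

Lemma sum_bezier_mean_dist c alpha (x : R) N K (f : R -> R) (a b : R) :
  admissible c -> 1 <= alpha -> 0 <= N -> domain c x ->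
  \sum_(k < K) bezier c alpha N k x * `|mean_value c N f k - a| <= b ->
  `|\sum_(k < K) bezier c alpha N k x * mean_value c N f k -
     a * \sum_(k < K) bezier c alpha N k x| <= b.
Proof.
move=> hc al N0 dx; apply: le_trans.
rewrite mulr_sumr -sumrB; apply: le_trans (ler_norm_sum _ _ _) _.
apply: ler_sum => k _; rewrite [a * _]mulrC -mulrBr normrM ger0_norm//.
exact: bezier_ge0.
Qed.

End approximation.

(** * From finite sums to the operator *)

Section durrmeyer_limit.
Context {R : realType}.
Implicit Types (c m : int) (x : R).

(** Through [mean_value] the end point terms of the operator become ordinary summands, so that one
    kind of sum covers every [c]. *)
Definition durrmeyer_sum c (alpha : R) (N : int) (f : R -> R) x K :=
  \sum_(k < K) bezier c alpha N k x * mean_value c N f k.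

Lemma durrmeyer_termE c m (alpha : R) n f x k : (0 < k)%N ->
  (c = -1 -> k%:Z != n%:Z + m * c) ->
  (n%:Z + (m + 1) * c)%:~R * durrmeyer_term c m alpha n f x k =
  bezier c alpha (n%:Z + m * c) k x * mean_value c (n%:Z + m * c) f k.
Proof.
move=> k0 kN; rewrite /mean_value /durrmeyer_term (gtn_eqF k0).
rewrite (_ : _ && _ = false); last first.
  by apply/negP => /andP[/eqP/kN/negPf->].
have e1 : n%:Z + (m + 1) * c = n%:Z + m * c + c by ring.
have e2 : n%:Z + (m + 2) * c = n%:Z + m * c + 2 * c by ring.
by rewrite e1 e2 /durrmeyer_mean mulrCA.
Qed.

Lemma durrmeyer_sum_recl c m (alpha : R) n f x K :
  (c = -1 -> K%:Z < n%:Z + m * c) ->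
  durrmeyer_sum c alpha (n%:Z + m * c) f x K.+1 =
  (n%:Z + (m + 1) * c)%:~R * (\sum_(1 <= k < K.+1) durrmeyer_term c m alpha n f x k)
  + bezier c alpha (n%:Z + m * c) 0 x * f 0.
Proof.
move=> KN; rewrite /durrmeyer_sum big_ord_recl /= [mean_value _ _ _ 0](_ : _ = f 0)// addrC.
congr (_ + _); rewrite big_add1 big_mkord mulr_sumr; apply: eq_bigr => i _.
rewrite durrmeyer_termE// => /KN; have := ltn_ord i.
by move: (n%:Z + m * c) => N; rewrite /bump /=; lia.
Qed.

Lemma durrmeyer_bernsteinE m (alpha : R) n (f : R -> R) x (N := n%:Z + m * -1) :
  0 < N -> durrmeyer (-1) m alpha n f x = durrmeyer_sum (-1) alpha N f x `|N|.+1.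
Proof.
move=> N0; rewrite /durrmeyer eqxx.
have -> : n%:Z - m = N by rewrite /N; ring.
case E : `|N|%N => [|d]; first lia.
have NE : N = d.+1%:Z by lia.
rewrite /durrmeyer_sum big_ord_recr /= -/(durrmeyer_sum _ _ _ _ _ _).
rewrite durrmeyer_sum_recl; last by rewrite -/N; lia.
by rewrite /mean_value NE !eqxx.
Qed.

(** The operator is written with [limn], which is meaningful only along a convergent sequence; the
    series is recovered from these sums by removing the head and dividing by the nonzero factor. *)
Lemma cvg_durrmeyer_sum c m (alpha : R) n (f : R -> R) x (l : R) : 0 <= c ->
  (n%:Z + (m + 1) * c) != 0 ->
  durrmeyer_sum c alpha (n%:Z + m * c) f x @ \oo --> l ->
  durrmeyer c m alpha n f x = l.
Proof.
move=> c0 rho0 cl; rewrite /durrmeyer (_ : (c == -1) = false); last by lia.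
set rho : R := (_)%:~R; set h := _ * f 0.
have r0 : rho != 0 by rewrite intr_eq0.
have : (fun K => \sum_(1 <= k < K) durrmeyer_term c m alpha n f x k) @ \oo -->
    rho^-1 * (l - h).
  rewrite -cvg_shiftS.
  have : (fun K => rho^-1 * (durrmeyer_sum c alpha (n%:Z + m * c) f x K.+1 - h)) @ \oo
      --> rho^-1 * (l - h).
    apply: cvgM; first exact: cvg_cst.
    by apply: cvgB; [rewrite cvg_shiftS|exact: cvg_cst].
  apply: cvg_trans; apply: near_eq_cvg; near=> K.
  by rewrite durrmeyer_sum_recl ?addrK ?mulKf//; lia.
move=> /cvg_lim -> //; by rewrite mulVKf// subrK.
Unshelve. all: by end_near. Qed.

Lemma cvg_of_abs_sum_bounded (u : nat -> R) (b : R) :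
  (forall K, \sum_(k < K) `|u k| <= b) ->
  cvgn (fun K => \sum_(k < K) u k).
Proof.
move=> ub; have : cvgn [normed series u].
  apply: nondecreasing_is_cvgn.
    by apply/nondecreasing_seqP => k; rewrite /= seriesSr lerDl.
  by exists b => _ [k _ <-]; rewrite /= seriesEord /=; exact: ub.
by move=> /normed_cvg; rewrite seriesEord.
Qed.

Lemma sum_bezier_bernstein c (alpha : R) N x : c = -1 -> 0 <= N -> domain c x ->
  1 <= alpha -> \sum_(k < `|N|.+1) bezier c alpha N k x = 1.
Proof.
move=> c1 N0 dx al; have hc : admissible c by left.
rewrite sum_bezier// (_ : mass c N _ x = 1).
  by rewrite subrr powR0 ?subr0// gt_eqF// (lt_le_trans _ al).
have := mass_cvg c N x hc N0 dx; rewrite -(cvg_shiftn `|N|.+1) => h.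
(* Beyond index [N] the Bernstein basis functions vanish, so the masses are constant and equal to
   their limit [1]. *)
suff h' : (fun K => mass c N (K + `|N|.+1) x) @ \oo --> mass c N `|N|.+1 x.
  exact: cvg_unique h' h.
rewrite (_ : (fun K => _) = (fun=> mass c N `|N|.+1 x)); first exact: cvg_cst.
apply/funext; elim=> [|K ih]; first by rewrite add0n.
by rewrite addSn massS ih basis_fun_gt ?addr0//; lia.
Qed.

End durrmeyer_limit.

(** * The estimate for all large [n], with a constant depending on [alpha] only *)

Theorem theorem3p2 (R : realType) (c m : int) (alpha beta : R)
    (hc : c = -1 \/ 0 <= c) (halpha : 1 <= alpha) (hbeta : 0 <= beta <= 1) :
  exists C : R, 0 < C /\
  exists n0 : nat, forall n : nat, (0 < n)%N -> (n0 <= n)%N ->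
  forall f : R -> R, continuous_bounded (domain c) f ->
  forall x : R, domain c x ->
    `|durrmeyer c m alpha n f x - f x| <=
      C * ditzian_totik c beta f (weight c x `^ (1 - beta) / Num.sqrt n%:R).
Proof.
exists (13 * alpha); split; first by rewrite mulr_gt0// (lt_le_trans _ halpha).
(* Beyond this threshold [N = n + m c] satisfies [1 < N], [2 c < N], [N + c != 0] and
   [n <= 2 (N - c)]. *)
exists (2 + 4 * `|c| + 2 * `|(m * c)%R|)%N => n npos hn f cbf x dx.
have [N1 [cN [rho0 nN]]] : 1 < n%:Z + m * c /\ 2 * c < n%:Z + m * c /\
    n%:Z + (m + 1) * c != 0 /\ n%:Z <= 2 * (n%:Z + m * c - c).
  clear - hc hn; rewrite [(m + 1) * c]mulrDl mul1r; move: (m * c) hn => mc hn.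
  by case: hc; lia.
have sn0 : 0 < Num.sqrt n%:R :> R by rewrite sqrtr_gt0 ltr0n.
have snN : Num.sqrt n%:R ^+ 2 <= 2 * (n%:Z + m * c - c)%:~R :> R.
  rewrite sqr_sqrtr// -[2]/(2%:~R) -intrM -[n%:R]/((n%:Z)%:~R) ler_int//.
set w := ditzian_totik _ _ _ _; set N := n%:Z + m * c in N1 cN nN snN *.
have N0 : 0 <= N by clear - N1; lia.
have bound K : (c = -1 -> K%:Z <= N + 1) ->
    \sum_(k < K) bezier c alpha N k x * `|mean_value c N f k - f x| <=
      13 * alpha * w.
  by move=> KN; exact: sum_bezier_dist.
case: (hc) => [c1|c0].
  have KN : c = -1 -> (`|N|.+1)%:Z <= N + 1 by clear - N0; lia.
  have := sum_bezier_mean_dist c alpha x N _ f (f x) _ hc halpha N0 dx (bound _ KN).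
  rewrite sum_bezier_bernstein// mulr1.
  rewrite c1 durrmeyer_bernsteinE; last by rewrite -c1; clear - N1; lia.
  by rewrite -c1.
have bound' K := bound K (fun c1 => ltac:(lia)).
(* For [0 <= c] the centred series converges absolutely. Adding [f x] times the weights, whose sum
   is [1], shows that the operator is a true limit and that its error is the limit [l] of the
   centred sums. *)
pose u k := bezier c alpha N k x * (mean_value c N f k - f x).
have uB K : \sum_(k < K) `|u k| <= 13 * alpha * w.
  apply: le_trans (bound' K); apply: ler_sum => k _.
  by rewrite normrM ger0_norm// bezier_ge0.
have /cvg_ex[l ul] := cvg_of_abs_sum_bounded u _ uB.
have sE K : durrmeyer_sum c alpha N f x K =
    \sum_(k < K) u k + f x * \sum_(k < K) bezier c alpha N k x.
  rewrite /durrmeyer_sum mulr_sumr -big_split; apply: eq_bigr => k _ /=.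
  by rewrite /u; ring.
have sl : durrmeyer_sum c alpha N f x @ \oo --> l + f x * 1.
  rewrite (_ : durrmeyer_sum _ _ _ _ _ = (fun K => \sum_(k < K) u k +
    f x * \sum_(k < K) bezier c alpha N k x)); last by apply/funext => K; exact: sE.
  apply: cvgD; first exact: ul.
  by apply: cvgM; [exact: cvg_cst|exact: sum_bezier_cvg].
rewrite (cvg_durrmeyer_sum c m alpha n f x _ c0 rho0 sl) mulr1 addrK.
have nl : (fun K => `|\sum_(k < K) u k|) @ \oo --> `|l| by exact: cvg_norm ul.
rewrite -(cvg_lim _ nl)//; apply: limr_le; first exact: cvgP nl.
near=> K; exact: le_trans (ler_norm_sum _ _ _) (uB K).
Unshelve. all: by end_near. Qed.
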